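(* For any $\eta_0>0$ and any unbounded function $H\in\mathrm{Har}_+(\mathbb{D})$, there exists a Blaschke product $B$ such that $H\in\mathcal{H}(B)$ but $(1+\eta_0)H\notin\mathcal{H}(B)$.
   Context: $\mathbb{D}$ is the open unit disc of $\mathbb{C}$. $\mathrm{Har}_+(\mathbb{D})$ is the cone of positive harmonic functions in $\mathbb{D}$. The pseudohyperbolic distance is $\rho(a_1,a_2)=\left|\frac{a_1-a_2}{1-\overline{a_2}a_1}\right|$, and $\rho(z,\Lambda)=\inf_{\lambda\in\Lambda}\rho(z,\lambda)$. A function $F$ with values in $[0,+\infty)$ has a harmonic majorant on a set $E\subset\mathbb{D}$ if there exists $H_1\in\mathrm{Har}_+(\mathbb{D})$ such that $F(z)\leq H_1(z)$ for all $z\in E$ (only the values of $F$ on $E$ matter). For a Blaschke product $B$ with zero set $\Lambda$, $\mathcal{H}(B)$ denotes the set of functions $H\in\mathrm{Har}_+(\mathbb{D})$ such that $-\log|B|$ has a harmonic majorant on the set $\{z\in\mathbb{D}:\rho(z,\Lambda)\geq e^{-H(z)}\}$. Blaschke products may have multiple zeros. *)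

(* Defs.v *)
(* Stdlib reals with Coquelicot. *)
From Stdlib Require Import Reals.
From Coquelicot Require Import Coquelicot.
Open Scope R_scope.

(* Functions on the unit disc are total functions on C; their values outside
   the disc are never used. *)
Definition disc (z : C) : Prop := Cmod z < 1.

(* Since the disc is open, [ex_diff_n _ 2] at each of its points says that u is
   of class C^2 there. *)
Definition harmonic_on_disc (u : C -> R) : Prop :=
  forall x y : R, disc (x, y) ->
    let f := fun s t : R => u (s, t) in
    ex_diff_n f 2 x y /\
    partial_derive 2 0 f x y + partial_derive 0 2 f x y = 0.

Definition Har_pos (u : C -> R) : Prop :=
  harmonic_on_disc u /\ forall z : C, disc z -> 0 < u z.

Definition unbounded_on_disc (u : C -> R) : Prop :=
  ~ exists M : R, forall z : C, disc z -> Rabs (u z) <= M.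

Definition rho (a1 a2 : C) : R :=
  Cmod ((a1 - a2) / (1 - Cconj a2 * a1))%C.

(* The infimum is taken in [Rbar], so that it is +oo when L is empty. *)
Definition rho_set (z : C) (L : C -> Prop) : Rbar :=
  Glb_Rbar (fun r : R => exists l : C, L l /\ r = rho z l).

Definition has_harmonic_majorant_on (F : C -> R) (E : C -> Prop) : Prop :=
  exists H1 : C -> R, Har_pos H1 /\ forall z : C, E z -> F z <= H1 z.

(* A zero sequence is given by [a : nat -> option C]: repetitions encode
   multiplicities, and [None] entries contribute nothing, so that finite
   Blaschke products are included. *)
Definition blaschke_sequence (a : nat -> option C) : Prop :=
  (forall (n : nat) (l : C), a n = Some l -> disc l) /\
  ex_series (fun n : nat =>
    match a n with Some l => 1 - Cmod l | None => 0 end).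

(* The usual unimodular normalization |l| / l is written conj(l) / |l|. *)
Definition blaschke_factor (l z : C) : C :=
  if Ceq_dec l 0 then z
  else (Cconj l / RtoC (Cmod l) * ((l - z) / (1 - Cconj l * z)))%C.

Fixpoint blaschke_partial (a : nat -> option C) (n : nat) (z : C) : C :=
  match n with
  | O => 1%C
  | S m => (blaschke_partial a m z *
            match a m with Some l => blaschke_factor l z | None => 1 end)%C
  end.

Definition is_blaschke_product (B : C -> C) : Prop :=
  exists a : nat -> option C, blaschke_sequence a /\
    forall z : C, disc z ->
      filterlim (fun n : nat => blaschke_partial a n z)
                eventually (locally (B z)).

Definition zero_set (B : C -> C) (z : C) : Prop := disc z /\ B z = 0%C.

(* The class H(B).  On the set below rho(z, zero_set B) > 0, hence B z <> 0, so
   the convention [ln 0 = 0] plays no role. *)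
Definition calH (B : C -> C) (H : C -> R) : Prop :=
  Har_pos H /\
  has_harmonic_majorant_on
    (fun z : C => - ln (Cmod (B z)))
    (fun z : C => disc z /\
       Rbar_le (Finite (exp (- H z))) (rho_set z (zero_set B))).

(* Main.v *)
(* The Blaschke product is a product of clusters around points [l_k] tending to the circle
   with [H (l_k) = T_k], [T_k] tending to infinity: [M_k] copies of [l_k] and a grid of
   simple zeros of step about [e^(-(1+c)T_k) (1 - |l_k|)] filling a square of size
   comparable to [1 - |l_k|].  Near [l_k] every point is at distance less than [e^(-H)]
   from the grid, so that [-log |B|] need only be majorized away from the [l_k]; there it
   is bounded by a positive harmonic function as soon as [sum M_k (1 - |l_k|)] and the
   corresponding sum over the grids converge.  On the other hand the grid leaves
   points at distance comparable to its step from all zeros; at such points close to [l_k]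
   [-log |B|] is at least [M_k T_k], whereas positive harmonic functions are
   [O(1 / (1 - |z|))].  Since the level set [H = T_k] meets every circle
   of radius close enough to 1, [1 - |l_k|] can be chosen after [T_k] and as small as we
   please, which allows [sum M_k (1 - |l_k|)] finite with [M_k (1 - |l_k|) T_k] unbounded.
   The facts on positive harmonic functions come from the Poisson formula, proved by
   letting hyperbolic circles about a point shrink to it: by the Cauchy-Riemann equations
   for a harmonic conjugate, the mean over them is constant. *)
Require Import Defs.
From Stdlib Require Import Reals.
From Coquelicot Require Import Coquelicot.
From Stdlib Require Import Lra Lia Psatz Classical IndefiniteDescription List Cantor.
From Stdlib Require FinFun.
Import Defs.
Open Scope R_scope.

(** * C1 functions and harmonic functions on the disc *)


(** Copies of [l_k] alone would already defeat [H]: at pseudohyperbolic distance e^(-H) from [l_k]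
    they make -log |B| at least of size M_k H. The grid removes these points from the set that
    belongs to [H], while its gaps, wider than e^(-(1+eta0)H), keep some of them in the set that
    belongs to [(1 + eta0) H]. Part of the room given by the factor [1 + eta0] is lost, because near
    [l_k] the function [H] is only known to lie between [(1 - c) T_k] and [(1 + c) T_k]. The grid
    has a price of its own: about e^(2(1+c)T_k) zeros, and since the points to be majorized may come
    as close as e^(-H) to one of them, each zero counts with weight T_k (1 - |l_k|). The factor of 1
    - |l_k| in this price is fixed by T_k, so shrinking 1 - |l_k| makes the price as small as
    desired, while M_k is raised to keep M_k (1 - |l_k|) about 2^(-k). With T_k proportional to 4^k,
    the product M_k (1 - |l_k|) T_k then grows like 2^k. *)

Lemma Cmod_sqr (z : C) : Cmod z ^ 2 = fst z ^ 2 + snd z ^ 2.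
Proof. unfold Cmod; rewrite pow2_sqrt; [easy | nra]. Qed.

Lemma disc_iff (z : C) : disc z <-> fst z ^ 2 + snd z ^ 2 < 1.
Proof.
  unfold disc; rewrite <- Cmod_sqr; pose proof (Cmod_ge_0 z); split; intro; nra.
Qed.

Lemma locally_2d_disc (x y : R) :
  x ^ 2 + y ^ 2 < 1 -> locally_2d (fun u v => u ^ 2 + v ^ 2 < 1) x y.
Proof.
  intro h.
  set (d := (1 - (x ^ 2 + y ^ 2)) / 8).
  assert (hd : 0 < d) by (unfold d; lra).
  exists (mkposreal d hd); simpl; intros u v hu hv.
  apply Rabs_def2 in hu; apply Rabs_def2 in hv.
  assert (-1 < x < 1) by nra. assert (-1 < y < 1) by nra.
  assert (d <= 1/8) by (unfold d; nra).
  assert ((u - x) * (u + x) <= d * (2 + d)).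
  { destruct (Rle_dec 0 (u + x)), (Rle_dec 0 (u - x)); nra. }
  assert ((v - y) * (v + y) <= d * (2 + d)).
  { destruct (Rle_dec 0 (v + y)), (Rle_dec 0 (v - y)); nra. }
  assert (8 * d = 1 - (x ^ 2 + y ^ 2)) by (unfold d; field).
  nra.
Qed.

(** The partial derivatives are data rather than [Derive], so that the same predicate covers an
    abstract [u] and functions given by integrals or by series differentiated term by term. Class
    C^2 is this predicate for [f], [fx] and [fy]. *)
Definition C1_disc (f fx fy : R -> R -> R) : Prop :=
  forall x y, x ^ 2 + y ^ 2 < 1 ->
    is_derive (fun s => f s y) x (fx x y) /\
    is_derive (fun t => f x t) y (fy x y) /\
    continuity_2d_pt fx x y /\ continuity_2d_pt fy x y.

Lemma C1_disc_differentiable f fx fy x y :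
  C1_disc f fx fy -> x ^ 2 + y ^ 2 < 1 ->
  differentiable_pt_lim f x y (fx x y) (fy x y).
Proof.
  intros hf h.
  apply filterdiff_differentiable_pt_lim.
  apply (is_derive_filterdiff f x y fx (fy x y)).
  - apply (locally_2d_locally (fun a b => is_derive (fun z => f z b) a (fx a b))).
    apply locally_2d_impl with (2 := locally_2d_disc x y h).
    apply locally_2d_forall; intros u v huv; apply (hf u v huv).
  - apply (hf x y h).
  - apply (proj1 (continuity_2d_pt_filterlim _ _ _)); apply (hf x y h).
Qed.

Lemma C1_disc_continuity f fx fy x y :
  C1_disc f fx fy -> x ^ 2 + y ^ 2 < 1 -> continuity_2d_pt f x y.
Proof.
  intros hf h; apply differentiable_continuity_pt.
  exists (fx x y), (fy x y); now apply C1_disc_differentiable.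
Qed.

Lemma C1_disc_chain f fx fy X Y t X' Y' :
  C1_disc f fx fy -> X t ^ 2 + Y t ^ 2 < 1 ->
  is_derive X t X' -> is_derive Y t Y' ->
  is_derive (fun t => f (X t) (Y t)) t (fx (X t) (Y t) * X' + fy (X t) (Y t) * Y').
Proof.
  intros hf h hX hY.
  apply is_derive_Reals; apply derivable_pt_lim_comp_2d.
  - now apply C1_disc_differentiable.
  - now apply is_derive_Reals.
  - now apply is_derive_Reals.
Qed.

Lemma harmonic_elim (u : C -> R) :
  harmonic_on_disc u ->
  exists fx fy fxx fxy fyx fyy,
    C1_disc (fun x y => u (x, y)) fx fy /\ C1_disc fx fxx fxy /\
    C1_disc fy fyx fyy /\
    forall x y, x ^ 2 + y ^ 2 < 1 -> fxx x y + fyy x y = 0.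
Proof.
  intro hu.
  set (f := fun x y => u (x, y)).
  set (D1 := fun (g : R -> R -> R) x y => Derive (fun s => g s y) x).
  set (D2 := fun (g : R -> R -> R) x y => Derive (fun t => g x t) y).
  assert (E : forall x y, x ^ 2 + y ^ 2 < 1 -> ex_diff_n f 2 x y /\
     D1 (D1 f) x y + D2 (D2 f) x y = 0).
  { intros x y h; destruct (hu x y) as [h1 h2]; [now apply disc_iff |].
    split; assumption. }
  exists (D1 f), (D2 f), (D1 (D1 f)), (D2 (D1 f)), (D1 (D2 f)), (D2 (D2 f)).
  split; [| split; [| split]]; intros x y h;
    destruct (E x y h) as [(c & d1 & d2 & (c1 & d11 & d12 & (c11 & _) & (c12 & _)) &
      (c2 & d21 & d22 & (c21 & _) & (c22 & _))) e];
    try exact e; refine (conj _ (conj _ (conj _ _)));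
    try assumption; apply Derive_correct; assumption.
Qed.

Lemma harmonic_intro (u : C -> R) fx fy fxx fxy fyx fyy :
  C1_disc (fun x y => u (x, y)) fx fy -> C1_disc fx fxx fxy ->
  C1_disc fy fyx fyy ->
  (forall x y, x ^ 2 + y ^ 2 < 1 -> fxx x y + fyy x y = 0) ->
  harmonic_on_disc u.
Proof.
  intros hf hx hy hL x y h; rewrite disc_iff in h; cbn [fst snd] in h.
  set (f := fun x y => u (x, y)) in *.
  assert (L1 : forall g g1 g2, C1_disc g g1 g2 -> forall x y, x ^ 2 + y ^ 2 < 1 ->
    Derive (fun z => g z y) x = g1 x y).
  { intros g g1 g2 hg x0 y0 h0; apply is_derive_unique; now apply hg. }
  assert (L2 : forall g g1 g2, C1_disc g g1 g2 -> forall x y, x ^ 2 + y ^ 2 < 1 ->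
    Derive (fun z => g x z) y = g2 x y).
  { intros g g1 g2 hg x0 y0 h0; apply is_derive_unique; now apply hg. }
  assert (N : forall P : R -> R -> Prop,
    (forall u v, u ^ 2 + v ^ 2 < 1 -> P u v) -> locally_2d P x y).
  { intros P hP; apply locally_2d_impl with (2 := locally_2d_disc x y h).
    now apply locally_2d_forall. }
  assert (I1 : forall g g1 g2, C1_disc g g1 g2 -> ex_diff_n g 1 x y).
  { intros g g1 g2 hg; simpl; split; [now apply (C1_disc_continuity g g1 g2) |].
    destruct (hg x y h) as (a & b & c & d).
    refine (conj _ (conj _ (conj (conj _ I) (conj _ I)))).
    - exists (g1 x y); easy.
    - exists (g2 x y); easy.
    - apply continuity_2d_pt_ext_loc with g1; [| easy].
      apply N; intros; symmetry; now apply (L1 g g1 g2).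
    - apply continuity_2d_pt_ext_loc with g2; [| easy].
      apply N; intros; symmetry; now apply (L2 g g1 g2). }
  split.
  - split; [now apply (C1_disc_continuity f fx fy) |].
    destruct (hf x y h) as (a & b & c & d).
    split; [exists (fx x y); easy |]; split; [exists (fy x y); easy |].
    split.
    + apply ex_diff_n_ext_loc with fx; [| now apply (I1 fx fxx fxy)].
      apply N; intros; symmetry; now apply (L1 f fx fy).
    + apply ex_diff_n_ext_loc with fy; [| now apply (I1 fy fyx fyy)].
      apply N; intros; symmetry; now apply (L2 f fx fy).
  - rewrite <- (hL x y h); unfold partial_derive; simpl; f_equal.
    + rewrite <- (L1 fx fxx fxy hx x y h); apply Derive_ext_loc.
      apply (locally_2d_1d_const_y (fun a b => Derive (fun x0 => f x0 b) a = fx a b)).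
      apply N; intros; now apply (L1 f fx fy).
    + rewrite <- (L2 fy fyx fyy hy x y h); apply Derive_ext_loc.
      apply (locally_2d_1d_const_x (fun a b => Derive (fun x0 => f a x0) b = fy a b)).
      apply N; intros; now apply (L2 f fx fy).
Qed.

(** * Harmonic conjugates *)

Lemma continuous_of_2d_l (g : R -> R -> R) x y :
  continuity_2d_pt g x y -> continuous (fun s => g s y) x.
Proof.
  intros h P [e he].
  destruct (h e) as [d hd]; exists d; intros z hz; apply he.
  apply hd; [exact hz | rewrite Rminus_diag, Rabs_R0; apply d].
Qed.

Lemma continuous_of_2d_r (g : R -> R -> R) x y :
  continuity_2d_pt g x y -> continuous (fun t => g x t) y.
Proof.
  intros h P [e he].
  destruct (h e) as [d hd]; exists d; intros z hz; apply he.
  apply hd; [rewrite Rminus_diag, Rabs_R0; apply d | exact hz].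
Qed.

Lemma is_derive_minus_R (f g : R -> R) x a b :
  is_derive f x a -> is_derive g x b -> is_derive (fun s => f s - g s) x (a - b).
Proof. exact (fun hf hg => is_derive_minus f g x a b hf hg). Qed.

Lemma between_sqr y s : Rmin 0 y <= s <= Rmax 0 y -> s ^ 2 <= y ^ 2.
Proof.
  unfold Rmin, Rmax; destruct (Rle_dec 0 y); intros; nra.
Qed.

(** The conjugate is the integral of [- fy dx + fx dy] along the broken line from 0 through [(x, 0)]
    to [(x, y)], which stays in the disc. *)
Lemma harmonic_conjugate f fx fy fxx fxy fyx fyy :
  C1_disc f fx fy -> C1_disc fx fxx fxy -> C1_disc fy fyx fyy ->
  (forall x y, x ^ 2 + y ^ 2 < 1 -> fxx x y + fyy x y = 0) ->
  exists v, C1_disc v (fun x y => - fy x y) fx.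
Proof.
  intros hf hx hy hL.
  exists (fun x y => RInt (fun s => fx x s) 0 y - RInt (fun s => fy s 0) 0 x).
  assert (Ix : forall x y, x ^ 2 + y ^ 2 < 1 -> ex_RInt (fun s => fx x s) 0 y).
  { intros x y h; apply (@ex_RInt_continuous R_CompleteNormedModule).
    intros z hz; apply between_sqr in hz.
    apply continuous_of_2d_r, (C1_disc_continuity fx fxx fxy); [easy | lra]. }
  assert (Iy : forall x, x ^ 2 < 1 -> ex_RInt (fun s => fy s 0) 0 x).
  { intros x h; apply (@ex_RInt_continuous R_CompleteNormedModule).
    intros z hz; apply between_sqr in hz.
    apply (continuous_of_2d_l fy z 0), (C1_disc_continuity fy fyx fyy); [easy | lra]. }
  intros x y h.
  assert (hx0 : x ^ 2 < 1) by nra.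
  pose proof (locally_2d_disc x y h) as hl.
  assert (hx00 : x ^ 2 + 0 ^ 2 < 1) by lra.
  refine (conj _ (conj _ (conj _ _))).
  - replace (- fy x y) with (RInt (fun s => Derive (fun u => fx u s) x) 0 y - fy x 0).
    + apply is_derive_minus_R.
      * apply (is_derive_RInt_param (fun x s => fx x s) 0 y x).
        -- apply locally_2d_1d_const_y in hl.
           apply filter_imp with (2 := hl).
           intros u hu t ht; apply between_sqr in ht.
           exists (fxx u t); apply hx; simpl in hu; lra.
        -- intros t ht; apply between_sqr in ht.
           assert (ht' : x ^ 2 + t ^ 2 < 1) by lra.
           apply continuity_2d_pt_ext_loc with fxx; [| now apply hx].
           apply locally_2d_impl with (2 := locally_2d_disc x t ht').
           apply locally_2d_forall; intros; symmetry; apply is_derive_unique; now apply hx.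
        -- apply locally_2d_1d_const_y in hl.
           apply filter_imp with (2 := hl). intros u hu; now apply Ix.
      * apply (is_derive_RInt (fun s => fy s 0) (fun x => RInt (fun s => fy s 0) 0 x) 0 x).
        -- pose proof (locally_2d_1d_const_y _ _ _ (locally_2d_disc x 0 hx00)) as hl0.
           apply filter_imp with (2 := hl0).
           intros u hu; apply (@RInt_correct R_CompleteNormedModule), Iy; simpl in hu; lra.
        -- apply (continuous_of_2d_l fy x 0), (C1_disc_continuity fy fyx fyy); easy.
    (* Harmonicity turns the integrand [fxx] into [- fyy], which has the primitive [- fy]; its value
       at the lower endpoint cancels the [fy x 0] of the horizontal integral. *)
    + rewrite (RInt_ext _ (fun s => - fyy x s)).
      * assert (E : is_RInt (fun s => - fyy x s) 0 y (minus (- fy x y) (- fy x 0))).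
        { apply (is_RInt_derive (fun s => - fy x s) (fun s => - fyy x s)); intros t ht;
          apply between_sqr in ht; assert (ht' : x ^ 2 + t ^ 2 < 1) by lra.
          - apply (is_derive_opp (fun s => fy x s)); now apply hy.
          - apply (continuous_opp (fun s => fyy x s)).
            apply continuous_of_2d_r; now apply hy. }
        rewrite (is_RInt_unique _ _ _ _ E); unfold minus, plus, opp; simpl; ring.
      * intros t ht.
        assert (ht' : x ^ 2 + t ^ 2 < 1).
        { assert (t ^ 2 <= y ^ 2) by (apply between_sqr; lra). lra. }
        pose proof (is_derive_unique _ _ _ (proj1 (hx x t ht'))) as E; cbn in E |- *; rewrite E.
        specialize (hL x t ht'); lra.
  - replace (fx x y) with (fx x y - 0) by ring.
    apply is_derive_minus_R.
    + apply (is_derive_RInt (fun s => fx x s) (fun y => RInt (fun s => fx x s) 0 y) 0 y).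
      * pose proof (locally_2d_1d_const_x _ _ _ hl) as hl0.
        apply filter_imp with (2 := hl0).
        intros u hu; apply (@RInt_correct R_CompleteNormedModule), Ix; easy.
      * apply (continuous_of_2d_r fx x y), (C1_disc_continuity fx fxx fxy); easy.
    + apply (@is_derive_const R_AbsRing R_NormedModule).
  - apply continuity_2d_pt_opp. now apply hf.
  - now apply hf.
Qed.

(** * Shrinking hyperbolic circles *)

Lemma continuity_2d_pt_comp (f g h : R -> R -> R) x y :
  continuity_2d_pt f (g x y) (h x y) -> continuity_2d_pt g x y ->
  continuity_2d_pt h x y -> continuity_2d_pt (fun u v => f (g u v) (h u v)) x y.
Proof.
  intros hf hg hh e.
  destruct (hf e) as [d hd].
  apply locally_2d_impl with (2 := hg d); apply locally_2d_impl with (2 := hh d).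
  apply locally_2d_forall; intros; now apply hd.
Qed.

(** Quotient rule for (N1 + i N2) / (D1 + i D2) in real coordinates: 1 / D^2 is written conj(D)^2 /
    |D|^4, hence the two conjugate factors in [q]. *)
Lemma is_derive_quotient_C (N1 N2 D1 D2 : R -> R) (n1 n2 d1 d2 x : R) :
  is_derive N1 x n1 -> is_derive N2 x n2 -> is_derive D1 x d1 -> is_derive D2 x d2 ->
  0 < D1 x ^ 2 + D2 x ^ 2 ->
  let w := ((n1, n2) * (D1 x, D2 x) - (N1 x, N2 x) * (d1, d2))%C in
  let q := (w * (D1 x, (- D2 x)%R) * (D1 x, (- D2 x)%R))%C in
  is_derive (fun x => (N1 x * D1 x + N2 x * D2 x) / (D1 x ^ 2 + D2 x ^ 2)) x
    (fst q / (D1 x ^ 2 + D2 x ^ 2) ^ 2) /\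
  is_derive (fun x => (N2 x * D1 x - N1 x * D2 x) / (D1 x ^ 2 + D2 x ^ 2)) x
    (snd q / (D1 x ^ 2 + D2 x ^ 2) ^ 2).
Proof.
  intros h1 h2 h3 h4 hq; cbv zeta.
  assert (e1 : ex_derive N1 x) by now exists n1.
  assert (e2 : ex_derive N2 x) by now exists n2.
  assert (e3 : ex_derive D1 x) by now exists d1.
  assert (e4 : ex_derive D2 x) by now exists d2.
  assert (E : forall f l, is_derive f x l -> Derive (fun x => f x) x = l)
    by (intros f l; apply is_derive_unique).
  split; (auto_derive; [repeat split; auto; lra |]);
    rewrite (E _ _ h1), (E _ _ h2), (E _ _ h3), (E _ _ h4); simpl; field; lra.
Qed.

Section Homotopy.

Variables a1 a2 : R.
Let A := a1 ^ 2 + a2 ^ 2.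
Hypothesis hA : A < 1.

Definition poisson (t : R) : R :=
  (1 - (a1 ^ 2 + a2 ^ 2)) / ((cos t - a1) ^ 2 + (sin t - a2) ^ 2).

(** With w = (e^(it) - a) / (1 - conj(a) e^(it)), the point (s w + a) / (1 + conj(a) s w) becomes N
    / D after multiplication by the denominator of w: N = e^(it) (s - A) + a (1 - s) and D = 1 - s A
    + conj(a) e^(it) (s - 1). *)
Let N1 s t := cos t * (s - A) + a1 * (1 - s).
Let N2 s t := sin t * (s - A) + a2 * (1 - s).
Let D1 s t := (1 - s * A) + (a1 * cos t + a2 * sin t) * (s - 1).
Let D2 s t := (a1 * sin t - a2 * cos t) * (s - 1).
Let Q s t := D1 s t ^ 2 + D2 s t ^ 2.

(* [hcircX + i hcircY] is the image of [s * w(t)] under the disc automorphism that maps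
   0 to a, with [s = sin tau] and [w(t)] the preimage of [e^(it)].  The
   reparametrization [s = sin tau] keeps the curves in the closed disc for all [tau]. *)
Definition hcircX (tau t : R) : R :=
  (N1 (sin tau) t * D1 (sin tau) t + N2 (sin tau) t * D2 (sin tau) t) / Q (sin tau) t.
Definition hcircY (tau t : R) : R :=
  (N2 (sin tau) t * D1 (sin tau) t - N1 (sin tau) t * D2 (sin tau) t) / Q (sin tau) t.

(** [hcirc_dX + i hcirc_dY] is (1 - A)^2 e^(it) / D^2, the common factor of both derivatives of the
    curve: it comes with [cos tau / poisson t] in [tau] and with [i sin tau] in [t]. Thus the
    [tau]-derivative weighted by the Poisson kernel is, up to a function of [tau], the
    [t]-derivative turned by a right angle; this is where the Cauchy-Riemann equations enter. *)
Let dz tau t : C :=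
  let s := sin tau in
  ((cos t, sin t) * (D1 s t, (- D2 s t)%R) * (D1 s t, (- D2 s t)%R))%C.
Definition hcirc_dX tau t : R := (1 - A) ^ 2 * fst (dz tau t) / Q (sin tau) t ^ 2.
Definition hcirc_dY tau t : R := (1 - A) ^ 2 * snd (dz tau t) / Q (sin tau) t ^ 2.

Lemma unit_circle t : cos t ^ 2 + sin t ^ 2 = 1.
Proof. pose proof (sin2_cos2 t); unfold Rsqr in *; nra. Qed.

Lemma dot_unit_sqr_le t : (a1 * cos t + a2 * sin t) ^ 2 <= A.
Proof.
  pose proof (unit_circle t).
  assert (0 <= (a1 * sin t - a2 * cos t) ^ 2) by apply pow2_ge_0.
  replace A with (A * (cos t ^ 2 + sin t ^ 2)) by (rewrite H; ring).
  unfold A; nra.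
Qed.

Lemma dot_unit_lt t : a1 * cos t + a2 * sin t < 1.
Proof. pose proof (dot_unit_sqr_le t); nra. Qed.

Lemma hcirc_den_pos s t : -1 <= s <= 1 -> 0 < Q s t.
Proof.
  intro hs.
  assert (0 < D1 s t).
  { pose proof (dot_unit_lt t) as hp.
    pose proof (dot_unit_sqr_le t) as hp2.
    unfold D1; set (p := a1 * cos t + a2 * sin t) in *.
    (* [D1] is affine in [s], with the values 1 - A at 1 and 1 + A - 2p >= (1 - p)^2 at -1. *)
    replace (1 - s * A + p * (s - 1)) with
      ((1 + s) / 2 * (1 - A) + (1 - s) / 2 * (1 + A - 2 * p)) by field.
    assert (0 < 1 + A - 2 * p) by nra.
    destruct (Rle_lt_dec s 0); nra. }
  unfold Q; assert (0 <= D2 s t ^ 2) by apply pow2_ge_0; nra.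
Qed.

Lemma poisson_den_pos t : 0 < (cos t - a1) ^ 2 + (sin t - a2) ^ 2.
Proof.
  pose proof (dot_unit_lt t); pose proof (unit_circle t).
  assert (0 <= A) by (unfold A; nra).
  pose proof (dot_unit_sqr_le t) as hp2.
  replace ((cos t - a1) ^ 2 + (sin t - a2) ^ 2) with
    ((cos t ^ 2 + sin t ^ 2) + A - 2 * (a1 * cos t + a2 * sin t)) by (unfold A; ring).
  rewrite H0; nra.
Qed.

Lemma hcirc_in_disc tau t : hcircX tau t ^ 2 + hcircY tau t ^ 2 <= 1.
Proof.
  pose proof (SIN_bound tau) as hs.
  pose proof (hcirc_den_pos (sin tau) t hs) as hQ.
  unfold hcircX, hcircY; set (s := sin tau) in *.
  replace (_ + _) with ((N1 s t ^ 2 + N2 s t ^ 2) / Q s t)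
    by (unfold Q in *; field; lra).
  apply Rmult_le_reg_r with (Q s t); [easy |].
  replace ((N1 s t ^ 2 + N2 s t ^ 2) / Q s t * Q s t) with (N1 s t ^ 2 + N2 s t ^ 2)
    by (field; lra).
  assert (E : Q s t - (N1 s t ^ 2 + N2 s t ^ 2) =
    (1 - A) * (1 - s ^ 2) * ((cos t - a1) ^ 2 + (sin t - a2) ^ 2)).
  { pose proof (unit_circle t) as h1.
    assert (h2 : sin t ^ 2 = 1 - cos t ^ 2) by lra.
    assert (h3 : sin t ^ 3 = sin t - sin t * cos t ^ 2).
    { replace (sin t ^ 3) with (sin t * sin t ^ 2) by ring; rewrite h2; ring. }
    unfold Q, N1, N2, D1, D2, A; ring_simplify; rewrite ?h2; ring. }
  pose proof (poisson_den_pos t).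
  assert (0 <= (1 - A) * (1 - s ^ 2)) by (apply Rmult_le_pos; nra).
  nra.
Qed.

Lemma hcirc_derive_tau tau t :
  is_derive (fun tau => hcircX tau t) tau (cos tau * hcirc_dX tau t / poisson t) /\
  is_derive (fun tau => hcircY tau t) tau (cos tau * hcirc_dY tau t / poisson t).
Proof.
  pose proof (hcirc_den_pos (sin tau) t (SIN_bound tau)) as hQ.
  pose proof (poisson_den_pos t) as hP.
  pose proof (unit_circle t) as hu.
  set (p := a1 * cos t + a2 * sin t). set (r := a1 * sin t - a2 * cos t).
  destruct (is_derive_quotient_C (fun tau => N1 (sin tau) t) (fun tau => N2 (sin tau) t)
    (fun tau => D1 (sin tau) t) (fun tau => D2 (sin tau) t)
    (cos tau * (cos t - a1)) (cos tau * (sin t - a2))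
    (cos tau * (p - A)) (cos tau * r) tau) as [h1 h2];
    try exact hQ; try (unfold N1, N2, D1, D2; auto_derive; [easy |]; unfold p, r; ring).
  assert (E : (((cos tau * (cos t - a1))%R, (cos tau * (sin t - a2))%R) *
      (D1 (sin tau) t, D2 (sin tau) t) - (N1 (sin tau) t, N2 (sin tau) t) *
      ((cos tau * (p - A))%R, (cos tau * r)%R))%C =
      (RtoC (cos tau * (1 - A) * ((cos t - a1) ^ 2 + (sin t - a2) ^ 2)) * (cos t, sin t))%C).
  { assert (E1 : cos t * ((cos t - a1) ^ 2 + (sin t - a2) ^ 2) =
       (cos t - a1) * (1 - p) + (sin t - a2) * r).
    { rewrite <- hu; unfold p, r; ring. }
    assert (E2 : sin t * ((cos t - a1) ^ 2 + (sin t - a2) ^ 2) =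
       (sin t - a2) * (1 - p) - (cos t - a1) * r).
    { rewrite <- hu; unfold p, r; ring. }
    apply injective_projections; cbn [fst snd Cmult Cminus Cplus Copp RtoC].
    - transitivity (cos tau * (1 - A) * ((cos t - a1) * (1 - p) + (sin t - a2) * r)).
      + unfold N1, N2, D1, D2, A, p, r; ring.
      + rewrite <- E1; ring.
    - transitivity (cos tau * (1 - A) * ((sin t - a2) * (1 - p) - (cos t - a1) * r)).
      + unfold N1, N2, D1, D2, A, p, r; ring.
      + rewrite <- E2; ring. }
  cbv beta zeta in h1, h2; rewrite E in h1, h2.
  assert (hA' : 1 - A <> 0) by lra.
  unfold hcirc_dX, hcirc_dY, dz, poisson.
  split.
  - eapply eq_ind; [exact h1 |]; fold A; unfold Q in *; simpl; field; repeat split; simpl in *; lra.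
  - eapply eq_ind; [exact h2 |]; fold A; unfold Q in *; simpl; field; repeat split; simpl in *; lra.
Qed.

Lemma hcirc_derive_t tau t :
  is_derive (fun t => hcircX tau t) t (- sin tau * hcirc_dY tau t) /\
  is_derive (fun t => hcircY tau t) t (sin tau * hcirc_dX tau t).
Proof.
  pose proof (hcirc_den_pos (sin tau) t (SIN_bound tau)) as hQ.
  set (p := a1 * cos t + a2 * sin t). set (r := a1 * sin t - a2 * cos t).
  unfold hcircX, hcircY, hcirc_dX, hcirc_dY, dz; set (s := sin tau) in *.
  destruct (is_derive_quotient_C (fun t => N1 s t) (fun t => N2 s t)
    (fun t => D1 s t) (fun t => D2 s t)
    (- sin t * (s - A)) (cos t * (s - A)) (- r * (s - 1)) (p * (s - 1)) t) as [h1 h2];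
    try exact hQ; try (unfold N1, N2, D1, D2; auto_derive; [easy |]; unfold p, r; ring).
  assert (E : (((- sin t * (s - A))%R, (cos t * (s - A))%R) *
      (D1 s t, D2 s t) - (N1 s t, N2 s t) *
      ((- r * (s - 1))%R, (p * (s - 1))%R))%C =
      (RtoC (s * (1 - A) ^ 2) * ((- sin t)%R, cos t))%C).
  { apply injective_projections; cbn [fst snd Cmult Cminus Cplus Copp RtoC];
    unfold N1, N2, D1, D2, A, p, r; ring. }
  cbv beta zeta in h1, h2; rewrite E in h1, h2.
  split.
  - eapply eq_ind; [exact h1 |]; unfold Q in *; simpl; field; repeat split; simpl in *; lra.
  - eapply eq_ind; [exact h2 |]; unfold Q in *; simpl; field; repeat split; simpl in *; lra.
Qed.

End Homotopy.

(** * The Poisson formula *)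

Lemma continuity_2d_pt_div (f g : R -> R -> R) x y :
  continuity_2d_pt f x y -> continuity_2d_pt g x y -> g x y <> 0 ->
  continuity_2d_pt (fun u v => f u v / g u v) x y.
Proof.
  intros; apply continuity_2d_pt_mult; [easy | now apply continuity_2d_pt_inv].
Qed.

Lemma continuity_2d_pt_pow2 (f : R -> R -> R) x y :
  continuity_2d_pt f x y -> continuity_2d_pt (fun u v => f u v ^ 2) x y.
Proof.
  intros; apply continuity_2d_pt_mult; [easy |].
  apply continuity_2d_pt_mult; [easy |]; apply continuity_2d_pt_const.
Qed.

Ltac cont2d :=
  repeat first
    [ apply continuity_2d_pt_const
    | apply continuity_2d_pt_id1
    | apply continuity_2d_pt_id2
    | apply (continuity_1d_2d_pt_comp cos); [apply continuity_cos |]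
    | apply (continuity_1d_2d_pt_comp sin); [apply continuity_sin |]
    | apply continuity_2d_pt_plus
    | apply continuity_2d_pt_minus
    | apply continuity_2d_pt_opp
    | apply continuity_2d_pt_pow2
    | apply continuity_2d_pt_div
    | apply continuity_2d_pt_mult ].

Lemma hcirc_continuity a1 a2 tau t : a1 ^ 2 + a2 ^ 2 < 1 ->
  continuity_2d_pt (hcircX a1 a2) tau t /\ continuity_2d_pt (hcircY a1 a2) tau t /\
  continuity_2d_pt (hcirc_dX a1 a2) tau t /\ continuity_2d_pt (hcirc_dY a1 a2) tau t.
Proof.
  intro hA.
  pose proof (hcirc_den_pos a1 a2 hA (sin tau) t (SIN_bound tau)) as hQ; cbv zeta in hQ.
  unfold hcircX, hcircY, hcirc_dX, hcirc_dY; cbn [fst snd Cmult].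
  refine (conj _ (conj _ (conj _ _))); cont2d; nra.
Qed.

Lemma poisson_continuous a1 a2 t : a1 ^ 2 + a2 ^ 2 < 1 -> continuous (poisson a1 a2) t.
Proof.
  intro hA; apply (continuous_of_2d_r (fun _ t => poisson a1 a2 t) 0 t).
  unfold poisson; cont2d; pose proof (poisson_den_pos a1 a2 hA t); lra.
Qed.

Lemma sqr_scale_lt_1 r x y : 0 < r < 1 -> x ^ 2 + y ^ 2 <= 1 -> (r * x) ^ 2 + (r * y) ^ 2 < 1.
Proof. intros; replace (_ + _) with (r ^ 2 * (x ^ 2 + y ^ 2)) by ring; nra. Qed.

(** [F tau] is the integral of [u] over the curve of parameter [tau], dilated by [r] and weighted by
    the Poisson kernel: at [tau = 0] the curve is the point [a], at [PI / 2] the unit circle. The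
    dilation keeps the curves in the open disc. The total mass of the kernel is left as an integral
    because [RInt_poisson] computes it from this very formula. *)
Lemma poisson_formula (u : C -> R) r a1 a2 :
  harmonic_on_disc u -> 0 < r < 1 -> a1 ^ 2 + a2 ^ 2 < 1 ->
  u (r * a1, r * a2) * RInt (poisson a1 a2) 0 (2 * PI) =
  RInt (fun t => u (r * cos t, r * sin t) * poisson a1 a2 t) 0 (2 * PI).
Proof.
  intros hu hr hA.
  destruct (harmonic_elim u hu) as (fx & fy & fxx & fxy & fyx & fyy & hf & hx & hy & hL).
  set (f := fun x y => u (x, y)) in *.
  destruct (harmonic_conjugate f fx fy fxx fxy fyx fyy hf hx hy hL) as [v hv].
  set (X := hcircX a1 a2). set (Y := hcircY a1 a2). set (P := poisson a1 a2).
  set (dX := hcirc_dX a1 a2). set (dY := hcirc_dY a1 a2).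
  assert (hin : forall tau t, (r * X tau t) ^ 2 + (r * Y tau t) ^ 2 < 1).
  { intros; apply sqr_scale_lt_1; [easy |]; now apply hcirc_in_disc. }
  assert (hP : forall t, 0 < P t).
  { intro t; apply Rdiv_lt_0_compat; [lra | now apply poisson_den_pos]. }
  set (G := fun tau t => f (r * X tau t) (r * Y tau t) * P t).
  set (W := fun tau t => fx (r * X tau t) (r * Y tau t) * dX tau t +
                         fy (r * X tau t) (r * Y tau t) * dY tau t).
  assert (cX : forall g, (forall x y, x ^ 2 + y ^ 2 < 1 -> continuity_2d_pt g x y) ->
    forall tau t, continuity_2d_pt (fun tau t => g (r * X tau t) (r * Y tau t)) tau t).
  { intros g hg tau t.
    destruct (hcirc_continuity a1 a2 tau t hA) as (c1 & c2 & _).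
    apply (continuity_2d_pt_comp g (fun tau t => r * X tau t) (fun tau t => r * Y tau t));
      [apply hg, hin | |]; (apply continuity_2d_pt_mult; [apply continuity_2d_pt_const | easy]). }
  assert (cW : forall tau t, continuity_2d_pt W tau t).
  { intros tau t; destruct (hcirc_continuity a1 a2 tau t hA) as (_ & _ & c1 & c2).
    apply continuity_2d_pt_plus; apply continuity_2d_pt_mult; try easy; apply cX;
      intros; now apply hf. }
  assert (dG : forall tau t, is_derive (fun tau => G tau t) tau (r * cos tau * W tau t)).
  { intros tau t; destruct (hcirc_derive_tau a1 a2 hA tau t) as [h1 h2].
    assert (k1 : is_derive (fun tau => r * X tau t) tau (r * (cos tau * dX tau t / P t)))
      by (now apply (is_derive_scal (fun tau => X tau t))).
    assert (k2 : is_derive (fun tau => r * Y tau t) tau (r * (cos tau * dY tau t / P t)))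
      by (now apply (is_derive_scal (fun tau => Y tau t))).
    pose proof (C1_disc_chain f fx fy _ _ tau _ _ hf (hin tau t) k1 k2) as k.
    pose proof (is_derive_scal_l _ _ _ (P t) k) as k3.
    eapply eq_ind; [exact k3 |].
    unfold W, scal; simpl; unfold mult; simpl; field; specialize (hP t); lra. }
  assert (cG : forall tau t, continuous (fun t => G tau t) t).
  { intros tau t; apply (continuous_mult (fun t => f (r * X tau t) (r * Y tau t)) P).
    - apply (continuous_of_2d_r (fun tau t => f (r * X tau t) (r * Y tau t)) tau t).
      apply cX; intros; now apply (C1_disc_continuity f fx fy).
    - now apply poisson_continuous. }
  set (F := fun tau => RInt (fun t => G tau t) 0 (2 * PI)).
  assert (eG : forall tau, ex_RInt (fun t => G tau t) 0 (2 * PI)).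
  { intro tau; apply (@ex_RInt_continuous R_CompleteNormedModule); intros; apply cG. }
  assert (dF : forall tau, is_derive F tau (RInt (fun t => r * cos tau * W tau t) 0 (2 * PI))).
  { intro tau.
    rewrite <- (RInt_ext (fun t => Derive (fun s => G s t) tau)).
    2:{ intros t _; apply is_derive_unique, dG. }
    apply (is_derive_RInt_param G 0 (2 * PI) tau).
    - apply filter_forall; intros s t _; eexists; apply dG.
    - intros t _; apply continuity_2d_pt_ext with (fun s t => r * cos s * W s t).
      + intros; symmetry; apply is_derive_unique, dG.
      + apply continuity_2d_pt_mult; [cont2d | apply cW].
    - apply filter_forall; intro; apply eG. }
  (* d/dt v(X, Y) = sin tau * W, and the curve is closed. *)
  assert (zW : forall tau, sin tau * RInt (W tau) 0 (2 * PI) = 0).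
  { intro tau.
    assert (E : is_RInt (fun t => r * sin tau * W tau t) 0 (2 * PI)
      (minus (v (r * X tau (2 * PI)) (r * Y tau (2 * PI))) (v (r * X tau 0) (r * Y tau 0)))).
    { apply (is_RInt_derive (fun t => v (r * X tau t) (r * Y tau t))).
      - intros t _; destruct (hcirc_derive_t a1 a2 hA tau t) as [h1 h2].
        assert (k1 : is_derive (fun t => r * X tau t) t (r * (- sin tau * dY tau t)))
          by (now apply (is_derive_scal (fun t => X tau t))).
        assert (k2 : is_derive (fun t => r * Y tau t) t (r * (sin tau * dX tau t)))
          by (now apply (is_derive_scal (fun t => Y tau t))).
        pose proof (C1_disc_chain v _ fx _ _ t _ _ hv (hin tau t) k1 k2) as k.
        eapply eq_ind; [exact k |]; unfold W; simpl; ring.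
      - intros t _; apply (continuous_mult (fun _ => r * sin tau) (W tau)).
        + apply continuous_const.
        + apply (continuous_of_2d_r W), cW. }
    assert (E0 : minus (v (r * X tau (2 * PI)) (r * Y tau (2 * PI)))
       (v (r * X tau 0) (r * Y tau 0)) = 0).
    { unfold X, Y, hcircX, hcircY; rewrite cos_2PI, sin_2PI, cos_0, sin_0.
      apply (@plus_opp_r R_AbelianGroup). }
    rewrite E0 in E; apply (is_RInt_unique (V := R_CompleteNormedModule)) in E.
    rewrite (RInt_scal (V := R_CompleteNormedModule) (W tau)) in E.
    - unfold scal in E; simpl in E; unfold mult in E; simpl in E; nra.
    - apply (@ex_RInt_continuous R_CompleteNormedModule); intros.
      apply (continuous_of_2d_r W), cW. }
  (* For these [tau] the factor [sin tau] can be divided out of [zW]; the mean value theorem asks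
     for the derivative in the open interval only. *)
  assert (dF0 : forall tau, 0 < tau < PI / 2 -> is_derive F tau 0).
  { intros tau ht; eapply eq_ind; [apply dF |].
    rewrite (RInt_scal (V := R_CompleteNormedModule) (W tau)).
    - assert (0 < sin tau) by (apply sin_gt_0; lra).
      specialize (zW tau); apply Rmult_integral in zW; destruct zW as [z | z]; [lra |].
      unfold scal; simpl; unfold mult; simpl.
      replace (RInt (fun y : R => W tau y) 0 (2 * PI)) with (RInt (W tau) 0 (2 * PI)) by easy.
      rewrite z; ring.
    - apply (@ex_RInt_continuous R_CompleteNormedModule); intros.
      apply (continuous_of_2d_r W), cW. }
  pose proof PI_RGT_0.
  destruct (MVT_gen F 0 (PI / 2) (fun _ => 0)) as (c & _ & hc).
  - rewrite Rmin_left, Rmax_right by lra; apply dF0.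
  - intros; apply derivable_continuous_pt; eexists; apply is_derive_Reals, dF.
  - assert (F0 : F 0 = u (r * a1, r * a2) * RInt P 0 (2 * PI)).
    { unfold F; rewrite (RInt_ext _ (fun t => scal (u (r * a1, r * a2)) (P t))).
      - rewrite (RInt_scal (V := R_CompleteNormedModule) P); [easy |].
        apply (@ex_RInt_continuous R_CompleteNormedModule); intros; now apply poisson_continuous.
      - intros t _; unfold G, X, Y, scal, f; simpl; unfold mult; simpl.
        pose proof (hcirc_den_pos a1 a2 hA (sin 0) t (SIN_bound 0)) as hQ; cbv zeta in hQ.
        unfold hcircX, hcircY; rewrite sin_0 in hQ |- *; do 4 f_equal; field; lra. }
    assert (F1 : F (PI / 2) = RInt (fun t => u (r * cos t, r * sin t) * P t) 0 (2 * PI)).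
    { unfold F; apply RInt_ext.
      intros t _; unfold G, X, Y, f.
      pose proof (hcirc_den_pos a1 a2 hA (sin (PI / 2)) t (SIN_bound _)) as hQ; cbv zeta in hQ.
      unfold hcircX, hcircY; rewrite sin_PI2 in hQ |- *; do 4 f_equal; field; lra. }
    rewrite <- F0, <- F1; lra.
Qed.

(** * Sums of harmonic functions Re (c_i / (1 - b_i z)) *)

Lemma Cmod_pair_le x y : Cmod (x, y) <= Rabs x + Rabs y.
Proof.
  apply Rsqr_incr_0_var; [| pose proof (Rabs_pos x); pose proof (Rabs_pos y); lra].
  rewrite !Rsqr_pow2, Cmod_sqr; simpl fst; simpl snd.
  rewrite <- (pow2_abs x), <- (pow2_abs y).
  pose proof (Rabs_pos x); pose proof (Rabs_pos y); nra.
Qed.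

Lemma Cmod_triangle_inv (z w : C) : Cmod z - Cmod w <= Cmod (z - w).
Proof.
  pose proof (Cmod_triangle (z - w) w) as h.
  replace (z - w + w)%C with z in h by ring; lra.
Qed.

Lemma Cmod_triangle_inv' (z w : C) : Cmod w - Cmod z <= Cmod (z - w).
Proof.
  rewrite <- (Cmod_opp (z - w)); replace (- (z - w))%C with (w - z)%C by ring.
  apply Cmod_triangle_inv.
Qed.

Lemma Cmod_one_sub_mul_ge (b z : C) r :
  Cmod b <= 1 -> Cmod z <= r -> 1 - r <= Cmod (1 - b * z).
Proof.
  intros hb hz.
  pose proof (Cmod_triangle_inv 1 (b * z)) as h.
  rewrite Cmod_1, Cmod_mult in h.
  assert (Cmod b * Cmod z <= 1 * r).
  { apply Rmult_le_compat; auto using Cmod_ge_0. }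
  lra.
Qed.

Lemma one_sub_mul_neq_0 (b z : C) : Cmod b <= 1 -> disc z -> (1 - b * z)%C <> 0.
Proof.
  intros hb hz; apply Cmod_gt_0.
  pose proof (Cmod_one_sub_mul_ge b z (Cmod z) hb (Rle_refl _)); unfold disc in hz; lra.
Qed.

Lemma Cmod_pow_le (A : C) k m : Cmod A <= k -> Cmod (A ^ m) <= k ^ m.
Proof. intro h; rewrite Cmod_pow; apply pow_incr; split; [apply Cmod_ge_0 | easy]. Qed.

(** [A] and [A'] stand for 1 / (1 - b z) and 1 / (1 - b w) with h = w - z; their difference is
    exactly b h A A', so the induction on [m] is purely algebraic. [K] depends only on [k] and [m],
    which makes the estimate uniform over the terms of a series. *)
Lemma Cpow_taylor_bound (k : R) (m : nat) : 0 <= k ->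
  exists K, 0 <= K /\ forall A A' b h : C,
    (A' - A = b * h * A * A')%C -> Cmod A <= k -> Cmod A' <= k -> Cmod b <= 1 ->
    Cmod (A' ^ m - A ^ m - RtoC (INR m) * b * h * A ^ (S m)) <= K * Cmod h ^ 2.
Proof.
  intro hk; induction m as [| m [K [hK IH]]].
  - exists 0; split; [lra |]; intros; simpl.
    replace (1 - 1 - 0 * b * h * (A * 1))%C with (RtoC 0) by ring.
    rewrite Cmod_0; lra.
  - exists (k * K + k ^ m * (k ^ 2 * k) + INR m * k ^ S m * (k * k)).
    assert (0 <= k ^ m) by now apply pow_le.
    pose proof (pos_INR m).
    split.
    { simpl; repeat apply Rplus_le_le_0_compat; repeat apply Rmult_le_pos; lra. }
    intros A A' b h e hA hA' hb.
    specialize (IH A A' b h e hA hA' hb).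
    replace (A' ^ S m - A ^ S m - RtoC (INR (S m)) * b * h * A ^ S (S m))%C with
      (A' * (A' ^ m - A ^ m - RtoC (INR m) * b * h * A ^ S m)
       + A ^ m * (A' - A - b * h * (A * A))
       + RtoC (INR m) * b * h * A ^ S m * (A' - A))%C
      by (rewrite S_INR, RtoC_plus; simpl; ring).
    assert (E : (A' - A - b * h * (A * A) = b * b * (h * h) * (A * A * A'))%C).
    { transitivity (b * h * A * (A' - A))%C; [| rewrite e; ring].
      rewrite <- (Cplus_0_r (A' - A)) at 1.
      transitivity ((A' - A) - b * h * A * A' + b * h * A * (A' - A))%C; [ring |].
      rewrite e at 1; ring. }
    rewrite E, e.
    assert (B1 : Cmod b * Cmod b <= 1) by (pose proof (Cmod_ge_0 b); nra).
    assert (ha := Cmod_ge_0 A). assert (ha' := Cmod_ge_0 A').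
    assert (hh := Cmod_ge_0 h). assert (hbb := Cmod_ge_0 b).
    assert (B2 : Cmod A * Cmod A <= k * k) by nra.
    assert (B3 : Cmod A * Cmod A' <= k * k) by nra.
    eapply Rle_trans; [apply Cmod_triangle |].
    rewrite 2!Rmult_plus_distr_r; apply Rplus_le_compat.
    eapply Rle_trans; [apply Cmod_triangle |]; apply Rplus_le_compat.
    + rewrite Cmod_mult, Rmult_assoc; apply Rmult_le_compat; auto using Cmod_ge_0.
    + rewrite !Cmod_mult.
      replace (k ^ m * (k ^ 2 * k) * Cmod h ^ 2) with
        (k ^ m * (1 * (Cmod h * Cmod h) * ((k * k) * k))) by ring.
      apply Rmult_le_compat; auto using Cmod_ge_0, Cmod_pow_le.
      { repeat apply Rmult_le_pos; lra. }
      apply Rmult_le_compat; try (repeat apply Rmult_le_pos; lra).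
      * apply Rmult_le_compat; nra.
      * apply Rmult_le_compat; nra.
    + rewrite !Cmod_mult, Cmod_R, (Rabs_pos_eq (INR m)) by easy.
      replace (INR m * Cmod b * Cmod h * Cmod (A ^ S m) * (Cmod b * Cmod h * Cmod A * Cmod A'))
        with (INR m * Cmod (A ^ S m) * ((Cmod b * Cmod b) * (Cmod A * Cmod A')) * Cmod h ^ 2) by ring.
      replace (k * k) with (1 * (k * k)) at 1 by ring.
      apply Rmult_le_compat_r; [apply pow2_ge_0 |].
      apply Rmult_le_compat.
      * apply Rmult_le_pos; auto using Cmod_ge_0.
      * repeat apply Rmult_le_pos; lra.
      * apply Rmult_le_compat_l; auto using Cmod_pow_le.
      * apply Rmult_le_compat; try easy; nra.
Qed.

(** The exponent [m] makes the family closed under differentiation: the derivative of c (1 - b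
    z)^(-m) is m c b (1 - b z)^(-m-1). *)
Definition cauchy_term (b : nat -> C) (m : nat) (c : nat -> C) (z : C) (i : nat) : R :=
  Re (c i * (/ (1 - b i * z)) ^ m).
Definition cauchy_series b m c z := Series (cauchy_term b m c z).

Definition summable (c : nat -> C) := ex_series (fun i => Cmod (c i)).

Lemma summable_scal (c d : nat -> C) k :
  (forall i, Cmod (d i) <= k * Cmod (c i)) -> summable c -> summable d.
Proof.
  intros h hc.
  apply (@ex_series_le R_AbsRing R_CompleteNormedModule) with (fun i => k * Cmod (c i)).
  - intro i; unfold norm; simpl; unfold abs; simpl.
    rewrite Rabs_pos_eq by apply Cmod_ge_0; apply h.
  - now apply (ex_series_scal_l k (fun i => Cmod (c i))).
Qed.

Lemma Series_nonneg (a : nat -> R) : (forall n, 0 <= a n) -> ex_series a -> 0 <= Series a.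
Proof.
  intros h hs.
  rewrite <- (Series_ext (fun n => Rabs (a n))) by (intro; now apply Rabs_pos_eq).
  eapply Rle_trans; [apply Rabs_pos | apply Series_Rabs].
  now apply ex_series_ext with a; [intro; symmetry; apply Rabs_pos_eq |].
Qed.

Lemma Rabs_series_le (a : nat -> R) (c : nat -> C) k :
  (forall i, Rabs (a i) <= Cmod (c i) * k) -> summable c ->
  ex_series a /\ Rabs (Series a) <= Series (fun i => Cmod (c i)) * k.
Proof.
  intros h hc.
  assert (e : ex_series (fun i => Cmod (c i) * k)) by now apply ex_series_scal_r.
  assert (e' : ex_series (fun i => Rabs (a i))).
  { apply (@ex_series_le R_AbsRing R_CompleteNormedModule) with (2 := e).
    intro i; unfold norm; simpl; unfold abs; simpl; rewrite Rabs_Rabsolu; apply h. }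
  split; [now apply ex_series_Rabs |].
  eapply Rle_trans; [now apply Series_Rabs |].
  rewrite <- Series_scal_r; apply Series_le; [| easy].
  intro i; split; [apply Rabs_pos | apply h].
Qed.

Section CauchySeries.

Variable b : nat -> C.
Hypothesis hb : forall i, Cmod (b i) <= 1.

Lemma kernel_bound i z r : Cmod z <= r -> r < 1 -> Cmod (/ (1 - b i * z)) <= / (1 - r).
Proof.
  intros hz hr; rewrite Cmod_inv.
  - apply Rinv_le_contravar; [lra |]; now apply Cmod_one_sub_mul_ge.
  - apply one_sub_mul_neq_0; [easy | unfold disc; lra].
Qed.

Lemma cauchy_term_le m c z r i : Cmod z <= r -> r < 1 ->
  Rabs (cauchy_term b m c z i) <= Cmod (c i) * (/ (1 - r)) ^ m.
Proof.
  intros hz hr; eapply Rle_trans; [apply re_le_Cmod |].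
  rewrite Cmod_mult; apply Rmult_le_compat_l; [apply Cmod_ge_0 |].
  now apply Cmod_pow_le, kernel_bound.
Qed.

Lemma ex_cauchy_series m c z : summable c -> disc z -> ex_series (cauchy_term b m c z).
Proof.
  intros hc hz.
  now apply (Rabs_series_le _ c _ (fun i => cauchy_term_le m c z _ i (Rle_refl _) hz)).
Qed.

(** The linear term is again a [cauchy_series], of exponent [S m]. One expansion with a uniform
    remainder yields both the partial derivatives, for w - z real or imaginary, and the
    continuity. *)
Lemma cauchy_series_taylor m c r : summable c -> r < 1 ->
  exists K, 0 <= K /\ forall z w, Cmod z <= r -> Cmod w <= r ->
    Rabs (cauchy_series b m c w - cauchy_series b m c z -
      cauchy_series b (S m) (fun i => RtoC (INR m) * c i * b i * (w - z))%C z)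
    <= K * Cmod (w - z) ^ 2.
Proof.
  intros hc hr.
  assert (hk : 0 < / (1 - r)) by (apply Rinv_0_lt_compat; lra).
  destruct (Cpow_taylor_bound (/ (1 - r)) m) as [K [hK HK]]; [lra |].
  exists (Series (fun i => Cmod (c i)) * K); split.
  { apply Rmult_le_pos; [| easy].
    apply Series_nonneg; [intro; apply Cmod_ge_0 | easy]. }
  intros z w hz hw.
  assert (dz : disc z) by (unfold disc; lra). assert (dw : disc w) by (unfold disc; lra).
  unfold cauchy_series.
  assert (s3 : summable (fun i => RtoC (INR m) * c i * b i * (w - z))%C).
  { apply summable_scal with c (INR m * Cmod (w - z)); [| easy].
    intro i; rewrite !Cmod_mult, Cmod_R, (Rabs_pos_eq _ (pos_INR m)).
    replace (INR m * Cmod (c i) * Cmod (b i) * Cmod (w - z)) with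
      (INR m * Cmod (w - z) * Cmod (c i) * Cmod (b i)) by ring.
    rewrite <- (Rmult_1_r (INR m * Cmod (w - z) * Cmod (c i))) at 2.
    apply Rmult_le_compat_l; [| easy].
    repeat apply Rmult_le_pos; auto using Cmod_ge_0, pos_INR. }
  assert (e1 := ex_cauchy_series m c w hc dw).
  assert (e2 := ex_cauchy_series m c z hc dz).
  assert (e3 := ex_cauchy_series (S m) _ z s3 dz).
  rewrite <- (Series_minus _ _ e1 e2), <- Series_minus by (try apply (ex_series_minus _ _ e1 e2); easy).
  rewrite Rmult_assoc; apply (Rabs_series_le _ c); [| easy].
  intro i; unfold cauchy_term.
  set (Az := (/ (1 - b i * z))%C). set (Aw := (/ (1 - b i * w))%C).
  replace (Re (c i * Aw ^ m) - Re (c i * Az ^ m) - Re (RtoC (INR m) * c i * b i * (w - z) * Az ^ S m))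
    with (Re (c i * (Aw ^ m - Az ^ m - RtoC (INR m) * b i * (w - z) * Az ^ S m))).
  2:{ replace (c i * (Aw ^ m - Az ^ m - RtoC (INR m) * b i * (w - z) * Az ^ S m))%C with
      (c i * Aw ^ m - c i * Az ^ m - RtoC (INR m) * c i * b i * (w - z) * Az ^ S m)%C by ring.
      unfold Re, Cminus, Cplus, Copp; simpl fst; ring. }
  eapply Rle_trans; [apply re_le_Cmod |]; rewrite Cmod_mult.
  apply Rmult_le_compat_l; [apply Cmod_ge_0 |].
  apply HK; [| now apply kernel_bound | now apply kernel_bound | easy].
  unfold Az, Aw; field; split; apply one_sub_mul_neq_0; easy.
Qed.

Lemma is_derive_of_quadratic (f : R -> R) x l K d : 0 < d -> 0 <= K ->
  (forall h, Rabs h < d -> Rabs (f (x + h) - f x - l * h) <= K * h ^ 2) ->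
  is_derive f x l.
Proof.
  intros hd hK h; apply is_derive_Reals; intros e he.
  assert (hm : 0 < Rmin d (e / (K + 1))).
  { apply Rmin_pos; [easy | apply Rdiv_lt_0_compat; lra]. }
  exists (mkposreal _ hm); simpl; intros y hy0 hy.
  assert (h1 : Rabs y < d) by (eapply Rlt_le_trans; [exact hy | apply Rmin_l]).
  assert (h2 : Rabs y < e / (K + 1)) by (eapply Rlt_le_trans; [exact hy | apply Rmin_r]).
  assert (hpos : 0 < Rabs y) by now apply Rabs_pos_lt.
  replace ((f (x + y) - f x) / y - l) with ((f (x + y) - f x - l * y) / y) by now field.
  unfold Rdiv; rewrite Rabs_mult, Rabs_inv.
  apply Rmult_lt_reg_r with (Rabs y); [easy |].
  rewrite Rmult_assoc, Rinv_l, Rmult_1_r by lra.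
  eapply Rle_lt_trans; [apply h, h1 |].
  rewrite <- (pow2_abs y).
  assert (Rabs y * (K + 1) < e).
  { replace e with (e / (K + 1) * (K + 1)) by (field; lra).
    apply Rmult_lt_compat_r; lra. }
  nra.
Qed.

Lemma disc_radius x y : x ^ 2 + y ^ 2 < 1 ->
  exists r d, r < 1 /\ 0 < d /\ d <= 1 /\ forall u v, Rabs (u - x) < d -> Rabs (v - y) < d ->
    Cmod (u, v) <= r.
Proof.
  intro h.
  assert (h' : Cmod (x, y) < 1) by now apply (disc_iff (x, y)).
  pose proof (Cmod_ge_0 (x, y)).
  exists ((1 + Cmod (x, y)) / 2), ((1 - Cmod (x, y)) / 4).
  split; [lra |]; split; [lra |]; split; [lra |]; intros u v hu hv.
  replace (u, v) with ((x, y) + (u - x, v - y)%R)%C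
    by (apply injective_projections; simpl; ring).
  pose proof (Cmod_triangle (x, y) (u - x, v - y)%R).
  pose proof (Cmod_pair_le (u - x) (v - y)); lra.
Qed.

Lemma cauchy_series_scal m c (k : R) z :
  cauchy_series b m (fun i => c i * RtoC k)%C z = cauchy_series b m c z * k.
Proof.
  unfold cauchy_series; rewrite <- Series_scal_r; apply Series_ext; intro i.
  unfold cauchy_term; rewrite <- Cmult_assoc, (Cmult_comm k), Cmult_assoc.
  unfold Re, RtoC; simpl fst; simpl snd; ring.
Qed.

Lemma summable_deriv (m : nat) c (e : C) : Cmod e <= 1 -> summable c ->
  summable (fun i => RtoC (INR m) * c i * b i * e)%C.
Proof.
  intros he; apply summable_scal with (INR m).
  intro i; rewrite !Cmod_mult, Cmod_R, (Rabs_pos_eq _ (pos_INR m)), Rmult_assoc.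
  rewrite <- (Rmult_1_r (INR m * Cmod (c i))) at 2.
  apply Rmult_le_compat_l; [apply Rmult_le_pos; auto using pos_INR, Cmod_ge_0 |].
  rewrite <- (Rmult_1_l 1); apply Rmult_le_compat; auto using Cmod_ge_0.
Qed.

Lemma cauchy_series_continuity m c x y : summable c -> x ^ 2 + y ^ 2 < 1 ->
  continuity_2d_pt (fun x y => cauchy_series b m c (x, y)) x y.
Proof.
  intros hc h.
  destruct (disc_radius x y h) as (r & d & hr & hd & hd1 & hin).
  destruct (cauchy_series_taylor m c r hc hr) as (K & hK & HK).
  set (L := Series (fun i => Cmod (c i)) * (INR m * (/ (1 - r)) ^ S m)).
  assert (hxy : Cmod (x, y) <= r) by (apply hin; rewrite Rminus_diag, Rabs_R0; lra).
  assert (hk : 0 < / (1 - r)) by (apply Rinv_0_lt_compat; lra).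
  assert (hL : 0 <= L).
  { apply Rmult_le_pos; [apply Series_nonneg; [intro; apply Cmod_ge_0 | easy] |].
    apply Rmult_le_pos; [apply pos_INR | apply pow_le; lra]. }
  assert (bd : forall u v, Rabs (u - x) < d -> Rabs (v - y) < d ->
    Rabs (cauchy_series b m c (u, v) - cauchy_series b m c (x, y)) <=
    (L + 2 * K) * (Rabs (u - x) + Rabs (v - y))).
  { intros u v hu hv.
    set (w := ((u, v) - (x, y))%C).
    assert (hw : Cmod w <= Rabs (u - x) + Rabs (v - y)) by apply Cmod_pair_le.
    pose proof (HK (x, y) (u, v) hxy (hin u v hu hv)) as h1; fold w in h1.
    set (c' := (fun i => RtoC (INR m) * c i * b i * w)%C) in h1.
    assert (h2 : Rabs (cauchy_series b (S m) c' (x, y)) <= L * Cmod w).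
    { unfold L; rewrite Rmult_assoc; apply (Rabs_series_le _ c); [| easy].
      intro i; eapply Rle_trans; [now apply (cauchy_term_le (S m) c' (x, y) r) |].
      unfold c'; rewrite !Cmod_mult, Cmod_R, (Rabs_pos_eq _ (pos_INR m)).
      replace (INR m * Cmod (c i) * Cmod (b i) * Cmod w * (/ (1 - r)) ^ S m) with
        (Cmod (b i) * (Cmod (c i) * (INR m * (/ (1 - r)) ^ S m * Cmod w))) by ring.
      rewrite <- (Rmult_1_l (Cmod (c i) * (INR m * (/ (1 - r)) ^ S m * Cmod w))) at 2.
      apply Rmult_le_compat_r; [| apply hb].
      repeat apply Rmult_le_pos; auto using Cmod_ge_0, pos_INR; try apply pow_le; lra. }
    pose proof (Cmod_ge_0 w).
    set (D := cauchy_series b m c (u, v) - cauchy_series b m c (x, y)) in *.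
    assert (Rabs D <= Rabs (D - cauchy_series b (S m) c' (x, y)) +
      Rabs (cauchy_series b (S m) c' (x, y))).
    { eapply Rle_trans; [| apply Rabs_triang]; right; f_equal; lra. }
    assert (K * Cmod w ^ 2 <= 2 * K * Cmod w).
    { assert (Cmod w * Cmod w <= 2 * Cmod w) by (apply Rmult_le_compat_r; lra); nra. }
    assert ((L + 2 * K) * Cmod w <= (L + 2 * K) * (Rabs (u - x) + Rabs (v - y)))
      by (apply Rmult_le_compat_l; lra).
    lra. }
  intro e; pose proof (cond_pos e) as he.
  assert (hm : 0 < Rmin d (e / (2 * (L + 2 * K + 1)))).
  { apply Rmin_pos; [easy | apply Rdiv_lt_0_compat; lra]. }
  exists (mkposreal _ hm); simpl; intros u v hu hv.
  pose proof (Rmin_l d (e / (2 * (L + 2 * K + 1)))).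
  pose proof (Rmin_r d (e / (2 * (L + 2 * K + 1)))).
  eapply Rle_lt_trans; [apply bd; lra |].
  apply Rle_lt_trans with ((L + 2 * K) * (e / (L + 2 * K + 1))).
  - apply Rmult_le_compat_l; [lra |].
    replace (e / (L + 2 * K + 1)) with (2 * (e / (2 * (L + 2 * K + 1)))) by (field; lra); lra.
  - apply Rmult_lt_reg_r with (L + 2 * K + 1); [lra |].
    replace ((L + 2 * K) * (e / (L + 2 * K + 1)) * (L + 2 * K + 1)) with ((L + 2 * K) * e)
      by (field; lra).
    nra.
Qed.

Lemma cauchy_series_C1 m c : summable c ->
  C1_disc (fun x y => cauchy_series b m c (x, y))
    (fun x y => cauchy_series b (S m) (fun i => RtoC (INR m) * c i * b i * 1)%C (x, y))
    (fun x y => cauchy_series b (S m) (fun i => RtoC (INR m) * c i * b i * Ci)%C (x, y)).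
Proof.
  intros hc x y h.
  assert (h1 : Cmod 1 <= 1) by (rewrite Cmod_1; lra).
  assert (hi : Cmod Ci <= 1) by (rewrite Cmod_Ci; lra).
  destruct (disc_radius x y h) as (r & d & hr & hd & hd1 & hin).
  destruct (cauchy_series_taylor m c r hc hr) as (K & hK & HK).
  assert (h0 : Rabs 0 < d) by now rewrite Rabs_R0.
  assert (E : forall e (s : R) w, (w - (x, y) = e * RtoC s)%C ->
    cauchy_series b (S m) (fun i => RtoC (INR m) * c i * b i * (w - (x, y)))%C (x, y) =
    cauchy_series b (S m) (fun i => RtoC (INR m) * c i * b i * e)%C (x, y) * s).
  { intros e s w hw; rewrite <- cauchy_series_scal; rewrite hw.
    apply Series_ext; intro i; unfold cauchy_term; do 2 f_equal; ring. }
  refine (conj _ (conj _ (conj _ _)));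
    try (apply cauchy_series_continuity; [apply summable_deriv |]; easy).
  - apply (is_derive_of_quadratic _ _ _ K d); [easy | easy |].
    intros s hs.
    rewrite <- (E 1 s (x + s, y)%R) by (apply injective_projections; simpl; ring).
    eapply Rle_trans; [apply HK; apply hin; rewrite ?Rminus_diag; try easy |].
    + now replace (x + s - x) with s by ring.
    + right; f_equal; rewrite <- (pow2_abs s), <- Cmod_R; do 2 f_equal.
      apply injective_projections; simpl; ring.
  - apply (is_derive_of_quadratic _ _ _ K d); [easy | easy |].
    intros s hs.
    rewrite <- (E Ci s (x, y + s)%R) by (apply injective_projections; simpl; ring).
    eapply Rle_trans; [apply HK; apply hin; rewrite ?Rminus_diag; try easy |].
    + now replace (y + s - y) with s by ring.
    + right; f_equal; rewrite <- (pow2_abs s), <- Cmod_R.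
      replace (Cmod s) with (Cmod (Ci * s)) by (rewrite Cmod_mult, Cmod_Ci; ring).
      do 2 f_equal; apply injective_projections; simpl; ring.
Qed.

Lemma cauchy_series_harmonic (k : R) c : summable c ->
  harmonic_on_disc (fun z => k + cauchy_series b 1 c z).
Proof.
  intro hc.
  assert (h1 : Cmod 1 <= 1) by (rewrite Cmod_1; lra).
  assert (hi : Cmod Ci <= 1) by (rewrite Cmod_Ci; lra).
  assert (hx := summable_deriv 1 c 1 h1 hc). assert (hy := summable_deriv 1 c Ci hi hc).
  eapply harmonic_intro.
  - intros x y h; destruct (cauchy_series_C1 1 c hc x y h) as (e1 & e2 & e3 & e4).
    refine (conj _ (conj _ (conj e3 e4))).
    + rewrite <- (Rplus_0_l (cauchy_series b 2 _ _)).
      apply (is_derive_plus (fun _ : R => k) (fun s => cauchy_series b 1 c (s, y))); [| exact e1].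
      apply (@is_derive_const R_AbsRing R_NormedModule).
    + rewrite <- (Rplus_0_l (cauchy_series b 2 _ _)).
      apply (is_derive_plus (fun _ : R => k) (fun s => cauchy_series b 1 c (x, s))); [| exact e2].
      apply (@is_derive_const R_AbsRing R_NormedModule).
  - now apply cauchy_series_C1.
  - now apply cauchy_series_C1.
  - intros x y _; cbv beta.
    (* Each derivative in [y] brings a factor [Ci], so the second one is the opposite of the second
       derivative in [x]. *)
    unfold cauchy_series at 2.
    rewrite (Series_ext _ (fun i => - cauchy_term b 3
      (fun i => RtoC (INR 2) * (RtoC (INR 1) * c i * b i * 1) * b i * 1)%C (x, y) i)).
    + rewrite Series_opp; unfold cauchy_series; ring.
    + intro i; unfold cauchy_term.
      set (A := ((/ (1 - b i * (x, y))) ^ 3)%C).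
      transitivity (Re (- (RtoC (INR 2) * (RtoC (INR 1) * c i * b i * 1) * b i * 1 * A))%C);
        [| easy].
      f_equal.
      assert (Ci * Ci = - 1)%C by (apply injective_projections; simpl; ring).
      transitivity (RtoC (INR 2) * (RtoC (INR 1) * c i * b i) * b i * A * (Ci * Ci))%C; [ring |].
      rewrite H; ring.
Qed.

End CauchySeries.

(** * Positive harmonic functions *)

Lemma disc_0 : disc 0.
Proof. unfold disc; rewrite Cmod_0; lra. Qed.

Lemma Re_inv (z : C) : z <> 0 -> Re (/ z) = Re z / (fst z ^ 2 + snd z ^ 2).
Proof. easy. Qed.

Lemma harmonic_circle_continuous u r t : harmonic_on_disc u -> 0 < r < 1 ->
  continuous (fun t => u (r * cos t, r * sin t)) t.
Proof.
  intros hu hr.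
  destruct (harmonic_elim u hu) as (fx & fy & fxx & fxy & fyx & fyy & hf & _).
  apply (continuous_of_2d_r (fun _ t => u (r * cos t, r * sin t)) 0 t).
  apply (continuity_2d_pt_comp (fun x y => u (x, y)) (fun _ t => r * cos t) (fun _ t => r * sin t));
    [| cont2d | cont2d].
  apply (C1_disc_continuity _ fx fy _ _ hf), sqr_scale_lt_1; [easy |].
  right; apply unit_circle.
Qed.

(** [poisson_formula] at the center 0, where the kernel is 1, is applied to Re ((1 + b z) / (1 - b
    z)) with b = conj(a) / r: on the circle of radius [r] this function is the Poisson kernel of
    [a], and at 0 it is 1. *)
Lemma RInt_poisson a1 a2 : a1 ^ 2 + a2 ^ 2 < 1 -> RInt (poisson a1 a2) 0 (2 * PI) = 2 * PI.
Proof.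
  intro hA.
  set (a := (a1, - a2) : C).
  assert (ha : Cmod a < 1).
  { apply disc_iff; unfold a; simpl fst; simpl snd; replace (_ + _) with (a1 ^ 2 + a2 ^ 2) by ring; easy. }
  pose proof (Cmod_ge_0 a).
  set (r := (1 + Cmod a) / 2). assert (hr : 0 < r < 1) by (unfold r; lra).
  set (b := (a / RtoC r)%C).
  assert (hr0 : RtoC r <> 0) by (intro e; apply RtoC_inj in e; lra).
  assert (hb : Cmod b <= 1).
  { unfold b; rewrite Cmod_div, Cmod_R, Rabs_pos_eq by (easy || lra).
    apply Rmult_le_reg_r with r; [lra |].
    unfold Rdiv; rewrite Rmult_assoc, Rinv_l by lra; unfold r; lra. }
  (* The weights 2^(-i) sum to 2, so this series with constant [b] is -1 + 2 Re (1 / (1 - b z)), and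
     its harmonicity is a case of [cauchy_series_harmonic]. *)
  set (u := fun z : C => -1 + cauchy_series (fun _ => b) 1 (fun i => RtoC ((/ 2) ^ i)) z).
  assert (hq : Rabs (/ 2) < 1) by (rewrite Rabs_pos_eq; lra).
  assert (hu : harmonic_on_disc u).
  { apply cauchy_series_harmonic; [easy |].
    apply ex_series_ext with (fun i => (/ 2) ^ i); [| now apply ex_series_geom].
    intro i; rewrite Cmod_R, Rabs_pos_eq; [easy | apply pow_le; lra]. }
  assert (hv : forall z, u z = -1 + 2 * Re (/ (1 - b * z))).
  { intro z; unfold u, cauchy_series; f_equal.
    rewrite (Series_ext _ (fun i => (/ 2) ^ i * Re (/ (1 - b * z)))).
    - rewrite Series_scal_r, Series_geom by easy; field.
    - intro i; unfold cauchy_term.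
      replace ((/ (1 - b * z)) ^ 1)%C with (/ (1 - b * z))%C by (simpl; ring).
      unfold Re, RtoC, Cmult; simpl fst; simpl snd; ring. }
  pose proof (poisson_formula u r 0 0 hu hr ltac:(lra)) as h.
  assert (E0 : forall t, poisson 0 0 t = 1).
  { intro t; unfold poisson; rewrite !Rminus_0_r, unit_circle; field. }
  rewrite (RInt_ext (poisson 0 0) (fun _ => 1)) in h by (intros; apply E0).
  rewrite RInt_const in h.
  rewrite (RInt_ext (fun t => u (r * cos t, r * sin t) * poisson 0 0 t) (poisson a1 a2)) in h.
  - rewrite <- h, hv.
    replace (1 - b * (r * 0, r * 0)%R)%C with (RtoC 1) by (apply injective_projections; simpl; ring).
    unfold scal; simpl; unfold mult; simpl; field.
  - intros t _; rewrite E0, Rmult_1_r, hv.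
    replace (b * (r * cos t, r * sin t)%R)%C with (a * (cos t, sin t))%C.
    2:{ replace ((r * cos t)%R, (r * sin t)%R) with (RtoC r * (cos t, sin t))%C
          by (apply injective_projections; simpl; ring).
        unfold b; field; easy. }
    unfold poisson; pose proof (poisson_den_pos a1 a2 hA t); pose proof (unit_circle t) as hc.
    assert (E : (1 - a1 * cos t - a2 * sin t) ^ 2 + (a2 * cos t - a1 * sin t) ^ 2 =
      (cos t - a1) ^ 2 + (sin t - a2) ^ 2).
    { transitivity (1 - 2 * (a1 * cos t + a2 * sin t) + (a1 ^ 2 + a2 ^ 2) * (cos t ^ 2 + sin t ^ 2));
        [ring |].
      rewrite hc; transitivity (cos t ^ 2 + sin t ^ 2 - 2 * (a1 * cos t + a2 * sin t) + a1 ^ 2 + a2 ^ 2);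
        [rewrite hc |]; ring. }
    assert (E2 : (cos t - a1) ^ 2 + (sin t - a2) ^ 2 =
      1 - 2 * (a1 * cos t + a2 * sin t) + a1 ^ 2 + a2 ^ 2) by (rewrite <- hc; ring).
    unfold a, Re; cbn [fst snd Cinv Cminus Cplus Copp Cmult RtoC].
    replace (1 + - (a1 * cos t - - a2 * sin t)) with (1 - a1 * cos t - a2 * sin t) by ring.
    replace (0 + - (a1 * sin t + - a2 * cos t)) with (a2 * cos t - a1 * sin t) by ring.
    rewrite E, E2; rewrite E2 in H0.
    match goal with |- ?l = ?k => change (@eq R l k) end; field; lra.
Qed.

Definition poisson_kernel (r : R) (z : C) (t : R) : R :=
  (r ^ 2 - Cmod z ^ 2) / Cmod ((r * cos t, r * sin t) - z) ^ 2.

Lemma poisson_kernel_eq r z t : 0 < r -> Cmod z < r ->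
  poisson_kernel r z t = poisson (fst z / r) (snd z / r) t /\
  (fst z / r) ^ 2 + (snd z / r) ^ 2 < 1 /\
  0 < Cmod ((r * cos t, r * sin t) - z) ^ 2.
Proof.
  intros hr hz.
  assert (hA : (fst z / r) ^ 2 + (snd z / r) ^ 2 < 1).
  { replace (_ + _) with (Cmod z ^ 2 / r ^ 2) by (rewrite Cmod_sqr; field; lra).
    apply Rmult_lt_reg_r with (r ^ 2); [nra |].
    unfold Rdiv; rewrite Rmult_assoc, Rinv_l by nra.
    pose proof (Cmod_ge_0 z); nra. }
  pose proof (poisson_den_pos _ _ hA t) as hp.
  assert (E : Cmod ((r * cos t, r * sin t) - z) ^ 2 =
    r ^ 2 * ((cos t - fst z / r) ^ 2 + (sin t - snd z / r) ^ 2))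
    by (rewrite Cmod_sqr; simpl fst; simpl snd; field; lra).
  split; [| split; [easy |]].
  - unfold poisson_kernel, poisson; rewrite E, Cmod_sqr; field.
    split; [lra |]. intro e.
    assert (r ^ 2 * ((cos t - fst z / r) ^ 2 + (sin t - snd z / r) ^ 2) = 0)
      by (rewrite <- e; field; lra).
    assert (0 < r ^ 2) by nra. nra.
  - rewrite E; assert (0 < r ^ 2) by nra; nra.
Qed.

Lemma poisson_mean u r z : harmonic_on_disc u -> 0 < r < 1 -> Cmod z < r ->
  is_RInt (fun t => u (r * cos t, r * sin t) * poisson_kernel r z t) 0 (2 * PI) (2 * PI * u z).
Proof.
  intros hu hr hz.
  destruct (poisson_kernel_eq r z 0 (proj1 hr) hz) as (_ & hA & _).
  pose proof (poisson_formula u r _ _ hu hr hA) as h.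
  rewrite RInt_poisson in h by easy.
  replace (r * (fst z / r), r * (snd z / r)) with z in h
    by (apply injective_projections; simpl; field; lra).
  replace (2 * PI * u z) with (u z * (2 * PI)) by ring; rewrite h.
  apply is_RInt_ext with (fun t => u (r * cos t, r * sin t) * poisson (fst z / r) (snd z / r) t).
  - intros t _; f_equal; symmetry; now apply poisson_kernel_eq.
  - apply (@RInt_correct R_CompleteNormedModule), (@ex_RInt_continuous R_CompleteNormedModule).
    intros t _; apply (continuous_mult (fun t => u (r * cos t, r * sin t))).
    + now apply harmonic_circle_continuous.
    + now apply poisson_continuous.
Qed.

Lemma circle_Cmod r t : 0 <= r -> Cmod (r * cos t, r * sin t) = r.
Proof.
  intro hr; unfold Cmod; simpl fst; simpl snd.
  replace (_ + _) with (r ^ 2 * (cos t ^ 2 + sin t ^ 2)) by ring.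
  rewrite unit_circle, Rmult_1_r; now apply sqrt_pow2.
Qed.

(** * Harnack inequalities and level sets *)

Lemma poisson_kernel_compare u r z w k : Har_pos u -> 0 < r < 1 -> Cmod z < r -> Cmod w < r ->
  (forall t, poisson_kernel r z t <= k * poisson_kernel r w t) -> u z <= k * u w.
Proof.
  intros [hu hpos] hr hz hw hk.
  pose proof (poisson_mean u r z hu hr hz) as h1.
  pose proof (is_RInt_scal _ _ _ k _ (poisson_mean u r w hu hr hw)) as h2.
  pose proof PI_RGT_0.
  assert (hle := is_RInt_le _ _ 0 (2 * PI) _ _ ltac:(lra) h1 h2).
  assert (hfin : 2 * PI * u z <= k * (2 * PI * u w)).
  { apply hle; intros t _; unfold scal; simpl; unfold mult; simpl.
    rewrite <- Rmult_assoc, (Rmult_comm k), Rmult_assoc.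
    apply Rmult_le_compat_l; [| apply hk].
    left; apply hpos; unfold disc; rewrite circle_Cmod; lra. }
  apply Rmult_le_reg_l with (2 * PI); [lra |]; lra.
Qed.

(** With r = (1 + |z|) / 2 the kernel of [z] is at most (r + |z|) / (r - |z|) <= 4 / (1 - |z|), and
    the kernel of 0 is 1. *)
Lemma Har_pos_growth u z : Har_pos u -> disc z -> u z <= 4 * u 0%C / (1 - Cmod z).
Proof.
  intros hu hz; unfold disc in hz.
  set (r := (1 + Cmod z) / 2).
  pose proof (Cmod_ge_0 z) as hz0. assert (hr : 0 < r < 1) by (unfold r; lra).
  assert (hzr : Cmod z < r) by (unfold r; lra).
  replace (4 * u 0%C / (1 - Cmod z)) with (4 / (1 - Cmod z) * u 0%C) by (field; lra).
  apply (poisson_kernel_compare u r); try easy; [rewrite Cmod_0; lra |].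
  intro t.
  replace (poisson_kernel r 0 t) with 1.
  2:{ unfold poisson_kernel; replace (_ - 0)%C with ((r * cos t)%R, (r * sin t)%R) by
        (apply injective_projections; simpl; ring).
      rewrite circle_Cmod, Cmod_0 by lra; field; lra. }
  unfold poisson_kernel.
  pose proof (Cmod_triangle_inv (r * cos t, r * sin t) z) as ht.
  rewrite circle_Cmod in ht by lra.
  set (e := Cmod ((r * cos t, r * sin t) - z)) in *.
  assert (he : 0 < e) by lra.
  assert (he2 : 0 < e ^ 2) by nra.
  apply Rmult_le_reg_r with (e ^ 2 * (1 - Cmod z)); [apply Rmult_lt_0_compat; lra |].
  replace (4 / (1 - Cmod z) * 1 * (e ^ 2 * (1 - Cmod z))) with (4 * e ^ 2) by (field; lra).
  replace ((r ^ 2 - Cmod z ^ 2) / e ^ 2 * (e ^ 2 * (1 - Cmod z))) with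
    ((r - Cmod z) * (r + Cmod z) * (2 * (r - Cmod z))).
  - assert ((r - Cmod z) ^ 2 <= e ^ 2) by nra.
    assert (r + Cmod z <= 2) by lra.
    assert (0 <= (r - Cmod z) ^ 2) by apply pow2_ge_0. nra.
  - unfold r; field; nra.
Qed.

(** Harnack's inequality with constants close to 1. The point [w] is at distance [s] from the circle
    of radius [r]; a displacement of at most [d * s] changes the numerator of the kernel by a factor
    between 1 - 2d and 1 + 2d, and the distance to a point of the circle by a factor between 1 - d
    and 1 + d. With d = c / 8 the quotients (1 + 2d) / (1 - d)^2 and (1 - 2d) / (1 + d)^2 stay
    between 1 - c and 1 + c. *)
Lemma Har_pos_local u z w c : Har_pos u -> disc w -> 0 < c <= 1 ->
  Cmod (z - w) <= c / 16 * (1 - Cmod w) ->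
  (1 - c) * u w <= u z <= (1 + c) * u w.
Proof.
  intros hu hw hc hzw; unfold disc in hw.
  pose proof (Cmod_ge_0 w) as hw0. pose proof (Cmod_ge_0 z) as hz0.
  set (s := (1 - Cmod w) / 2). set (r := (1 + Cmod w) / 2). set (d := c / 8).
  assert (hr : 0 < r < 1) by (unfold r; lra).
  assert (hs : r - Cmod w = s) by (unfold r, s; lra).
  assert (hd : Cmod (z - w) <= d * s) by (unfold d, s; lra).
  assert (hs0 : 0 < s) by (unfold s; lra).
  assert (hd0 : 0 < d <= / 8) by (unfold d; lra).
  assert (hz1 : Cmod z - Cmod w <= d * s).
  { eapply Rle_trans; [apply Cmod_triangle_inv | easy]. }
  assert (hz2 : Cmod w - Cmod z <= d * s).
  { eapply Rle_trans; [apply Cmod_triangle_inv' | easy]. }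
  assert (hzr : Cmod z < r) by nra. assert (hwr : Cmod w < r) by lra.
  assert (hK : forall t, 
     (1 - 2 * d) / (1 + d) ^ 2 * poisson_kernel r w t <= poisson_kernel r z t <=
     (1 + 2 * d) / (1 - d) ^ 2 * poisson_kernel r w t).
  { intro t; unfold poisson_kernel.
    set (e := ((r * cos t)%R, (r * sin t)%R) : C).
    assert (he : Cmod e = r) by (apply circle_Cmod; lra).
    assert (hew : s <= Cmod (e - w)).
    { pose proof (Cmod_triangle_inv e w); lra. }
    assert (h1 : Cmod (e - z) <= (1 + d) * Cmod (e - w)).
    { replace (e - z)%C with ((e - w) + - (z - w))%C by ring.
      eapply Rle_trans; [apply Cmod_triangle |]; rewrite Cmod_opp; nra. }
    assert (h2 : (1 - d) * Cmod (e - w) <= Cmod (e - z)).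
    { assert (Cmod (e - w) <= Cmod (e - z) + Cmod (z - w)).
      { replace (e - w)%C with ((e - z) + (z - w))%C by ring; apply Cmod_triangle. }
      nra. }
    set (x := Cmod (e - w)) in *. set (y := Cmod (e - z)) in *.
    assert (hy : 0 < y) by nra.
    set (N := r ^ 2 - Cmod w ^ 2). set (M := r ^ 2 - Cmod z ^ 2).
    assert (hN : N = s * (r + Cmod w)) by (unfold N; rewrite <- hs; ring).
    assert (hN0 : 0 < N) by (rewrite hN; nra).
    assert (hM : (1 - 2 * d) * N <= M <= (1 + 2 * d) * N).
    { assert (hMN : M - N = (Cmod w - Cmod z) * (Cmod w + Cmod z)) by (unfold M, N; ring).
      assert (- (d * s * (2 * r)) <= (Cmod w - Cmod z) * (Cmod w + Cmod z) <= d * s * (2 * r)).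
      { assert (0 <= d * s) by nra.
        split.
        - assert (0 <= (d * s + (Cmod w - Cmod z)) * (Cmod w + Cmod z)) by (apply Rmult_le_pos; lra).
          assert (0 <= d * s * (2 * r - (Cmod w + Cmod z))) by (apply Rmult_le_pos; lra). lra.
        - assert (0 <= (d * s - (Cmod w - Cmod z)) * (Cmod w + Cmod z)) by (apply Rmult_le_pos; lra).
          assert (0 <= d * s * (2 * r - (Cmod w + Cmod z))) by (apply Rmult_le_pos; lra). lra. }
      assert (d * s * (2 * r) <= 2 * d * N) by (rewrite hN; nra).
      lra. }
    assert (q1 : y ^ 2 <= (1 + d) ^ 2 * x ^ 2) by (rewrite <- Rpow_mult_distr; apply pow_incr; lra).
    assert (q2 : (1 - d) ^ 2 * x ^ 2 <= y ^ 2)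
      by (rewrite <- Rpow_mult_distr; apply pow_incr; nra).
    assert (hx2 : 0 < x ^ 2) by nra. assert (hy2 : 0 < y ^ 2) by nra.
    split.
    - apply Rmult_le_reg_r with ((1 + d) ^ 2 * x ^ 2 * y ^ 2).
      { repeat apply Rmult_lt_0_compat; nra. }
      replace (_ * _) with ((1 - 2 * d) * N * y ^ 2) by (field; nra).
      replace (M / y ^ 2 * ((1 + d) ^ 2 * x ^ 2 * y ^ 2)) with (M * ((1 + d) ^ 2 * x ^ 2))
        by (field; nra).
      apply Rmult_le_compat; nra.
    - apply Rmult_le_reg_r with ((1 - d) ^ 2 * x ^ 2 * y ^ 2).
      { repeat apply Rmult_lt_0_compat; nra. }
      replace (M / y ^ 2 * ((1 - d) ^ 2 * x ^ 2 * y ^ 2)) with (M * ((1 - d) ^ 2 * x ^ 2))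
        by (field; nra).
      replace (_ * _ * (_ * _)) with ((1 + 2 * d) * N * y ^ 2) by (field; nra).
      apply Rmult_le_compat; nra. }
  assert (hpos : 0 < u w) by now apply hu.
  assert (hd8 : c = 8 * d) by (unfold d; field).
  split.
  - assert (hl : u w <= (1 + d) ^ 2 / (1 - 2 * d) * u z).
    { apply (poisson_kernel_compare u r); try easy; intro t.
      apply Rmult_le_reg_l with ((1 - 2 * d) / (1 + d) ^ 2).
      - apply Rdiv_lt_0_compat; nra.
      - replace (_ * (_ * _)) with (poisson_kernel r z t) by (field; nra); apply hK. }
    assert ((1 - 2 * d) * u w <= (1 + d) ^ 2 * u z).
    { apply (Rmult_le_compat_l (1 - 2 * d)) in hl; [| lra].
      replace ((1 + d) ^ 2 * u z) with ((1 - 2 * d) * ((1 + d) ^ 2 / (1 - 2 * d) * u z)) by (field; nra).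
      easy. }
    apply Rmult_le_reg_l with ((1 + d) ^ 2); [nra |].
    eapply Rle_trans; [| exact H].
    rewrite <- Rmult_assoc; apply Rmult_le_compat_r; [lra |]; rewrite hd8; nra.
  - assert (hl : u z <= (1 + 2 * d) / (1 - d) ^ 2 * u w).
    { apply (poisson_kernel_compare u r); try easy; intro t; apply hK. }
    eapply Rle_trans; [exact hl |]; apply Rmult_le_compat_r; [lra |].
    apply Rmult_le_reg_r with ((1 - d) ^ 2); [nra |].
    replace ((1 + 2 * d) / (1 - d) ^ 2 * (1 - d) ^ 2) with (1 + 2 * d) by (field; nra).
    rewrite hd8; nra.
Qed.

(** On a circle that encloses a point where [u > T], the Poisson mean at that point forces a value
    above [T], and the mean at 0 forces a value below; the intermediate value theorem along the
    circle concludes. *)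
Lemma Har_pos_level u T : Har_pos u -> unbounded_on_disc u -> u 0%C < T ->
  exists r0, r0 < 1 /\ forall r, 0 < r < 1 -> r0 < r -> exists z, Cmod z = r /\ u z = T.
Proof.
  intros hu hunb hT.
  assert (hz0 : exists z0, disc z0 /\ T < u z0).
  { apply NNPP; intro hn; apply hunb; exists T; intros z hz.
    rewrite Rabs_pos_eq by (left; now apply hu).
    apply Rnot_lt_le; intro; apply hn; now exists z. }
  destruct hz0 as (z0 & hz0 & hTz).
  exists (Cmod z0); split; [easy |]; intros r hr hrz.
  pose proof PI_RGT_0 as hpi.
  assert (hmean : forall z, Cmod z < r ->
    is_RInt (fun t => T * poisson_kernel r z t) 0 (2 * PI) (2 * PI * T)).
  { intros z hz.
    apply is_RInt_ext with (fun t => scal T (1 * poisson_kernel r z t)).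
    - intros; unfold scal; simpl; unfold mult; simpl; ring.
    - replace (2 * PI * T) with (scal T (2 * PI * 1))
        by (unfold scal; simpl; unfold mult; simpl; ring).
      apply (is_RInt_scal (V := R_NormedModule)), (poisson_mean (fun _ => 1)); try easy.
      eapply (harmonic_intro (fun _ => 1) (fun _ _ => 0) (fun _ _ => 0) (fun _ _ => 0) (fun _ _ => 0)
        (fun _ _ => 0) (fun _ _ => 0)); try (intros; ring);
      intros x y _; (refine (conj _ (conj _ (conj _ _)));
        [apply (@is_derive_const R_AbsRing R_NormedModule)
        |apply (@is_derive_const R_AbsRing R_NormedModule)
        |apply continuity_2d_pt_const|apply continuity_2d_pt_const]). }
  assert (hker : forall z t, Cmod z < r -> 0 < poisson_kernel r z t).
  { intros z t hz; destruct (poisson_kernel_eq r z t (proj1 hr) hz) as (_ & _ & h).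
    apply Rdiv_lt_0_compat; [pose proof (Cmod_ge_0 z); nra | easy]. }
  assert (h1 : exists t, T < u (r * cos t, r * sin t)).
  { apply NNPP; intro hn.
    assert (2 * PI * u z0 <= 2 * PI * T); [| nra].
    apply (is_RInt_le _ _ 0 (2 * PI) _ _ ltac:(lra) (poisson_mean u r z0 (proj1 hu) hr hrz)
      (hmean z0 hrz)).
    intros t _; apply Rmult_le_compat_r; [left; now apply hker |].
    apply Rnot_lt_le; intro; apply hn; now exists t. }
  assert (h2 : exists t, u (r * cos t, r * sin t) < T).
  { apply NNPP; intro hn.
    assert (hc0 : Cmod 0 < r) by (rewrite Cmod_0; lra).
    assert (2 * PI * T <= 2 * PI * u 0%C); [| nra].
    apply (is_RInt_le _ _ 0 (2 * PI) _ _ ltac:(lra) (hmean 0%C hc0)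
       (poisson_mean u r 0 (proj1 hu) hr hc0)).
    intros t _; apply Rmult_le_compat_r; [left; now apply hker |].
    apply Rnot_lt_le; intro; apply hn; now exists t. }
  destruct h1 as [t1 h1]. destruct h2 as [t2 h2].
  destruct (IVT_gen (fun t => u (r * cos t, r * sin t)) t1 t2 T) as (t & _ & ht).
  - intro t; apply continuity_pt_filterlim, harmonic_circle_continuous; [apply hu | easy].
  - rewrite Rmin_right, Rmax_left by lra; lra.
  - exists (r * cos t, r * sin t); split; [apply circle_Cmod; lra | easy].
Qed.

(** * Finite sums and flattening of double sequences *)

Definition lsum {A : Type} (f : A -> R) (l : list A) : R :=
  fold_right (fun x s => f x + s) 0 l.

Lemma lsum_app {A} (f : A -> R) l1 l2 : lsum f (l1 ++ l2) = lsum f l1 + lsum f l2.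
Proof. induction l1; simpl; [ring | rewrite IHl1; ring]. Qed.

Lemma lsum_map {A B} (g : A -> B) (f : B -> R) l : lsum f (map g l) = lsum (fun x => f (g x)) l.
Proof. induction l; simpl; [easy | now rewrite IHl]. Qed.

Lemma lsum_le_length {A} (f : A -> R) l k : (forall x, In x l -> f x <= k) ->
  lsum f l <= INR (length l) * k.
Proof.
  induction l as [| a l IH]; intro h; [simpl; lra |].
  change (length (a :: l)) with (S (length l)); rewrite S_INR; simpl.
  specialize (IH (fun x hx => h x (or_intror hx))); specialize (h a (or_introl eq_refl)); lra.
Qed.

Lemma lsum_ge_length {A} (f : A -> R) l k : (forall x, In x l -> k <= f x) ->
  INR (length l) * k <= lsum f l.
Proof.
  induction l as [| a l IH]; intro h; [simpl; lra |].
  change (length (a :: l)) with (S (length l)); rewrite S_INR; simpl.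
  specialize (IH (fun x hx => h x (or_intror hx))); specialize (h a (or_introl eq_refl)); lra.
Qed.

Lemma lsum_incl {A} (f : A -> R) l l' : (forall x, 0 <= f x) -> NoDup l -> incl l l' ->
  lsum f l <= lsum f l'.
Proof.
  intros hf hd; revert l'; induction hd as [| x l hx hd IH]; intros l' hi.
  - simpl; induction l'; simpl; [lra | specialize (hf a)].
    assert (0 <= lsum f l') by (apply IHl'; intros ? []). lra.
  - destruct (in_split x l') as (l1 & l2 & ->); [apply hi; now left |].
    rewrite lsum_app; simpl.
    assert (lsum f l <= lsum f (l1 ++ l2)); [| rewrite lsum_app in H; lra].
    apply IH; intros y hy.
    assert (hy' : In y (l1 ++ x :: l2)) by (apply hi; now right).
    apply in_app_iff in hy'; apply in_app_iff.
    destruct hy' as [| [-> |]]; [now left | contradiction | now right].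
Qed.

Lemma sum_n_lsum (f : nat -> R) n : sum_n f n = lsum f (seq 0 (S n)).
Proof.
  induction n; [rewrite sum_O; simpl; ring |].
  rewrite sum_Sn, IHn, (seq_S (S n) 0), lsum_app; simpl.
  unfold plus; simpl; ring.
Qed.

Lemma lsum_seq_le_Series (f : nat -> R) n : (forall n, 0 <= f n) -> ex_series f ->
  lsum f (seq 0 n) <= Series f.
Proof.
  intros hf hs.
  assert (h : sum_n f n <= Series f).
  { apply (is_lim_seq_incr_compare (sum_n f)).
    - now apply Series_correct.
    - intro m; rewrite sum_Sn; unfold plus; simpl; specialize (hf (S m)); lra. }
  rewrite sum_n_lsum, seq_S, lsum_app in h; simpl in h; specialize (hf n); lra.
Qed.

Lemma ex_series_bounded (f : nat -> R) K : (forall n, 0 <= f n) ->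
  (forall n, lsum f (seq 0 n) <= K) -> ex_series f.
Proof.
  intros hf hK.
  destruct (ex_finite_lim_seq_incr (sum_n f) K) as [l hl].
  - intro n; rewrite sum_Sn; unfold plus; simpl; specialize (hf (S n)); lra.
  - intro n; rewrite sum_n_lsum; apply hK.
  - now exists l.
Qed.

Definition cantor_flatten {A} (f : nat -> nat -> A) (n : nat) : A :=
  f (fst (of_nat n)) (snd (of_nat n)).

Lemma lsum_list_prod (f : nat -> nat -> R) l1 l2 :
  lsum (fun p => f (fst p) (snd p)) (list_prod l1 l2) = lsum (fun k => lsum (f k) l2) l1.
Proof.
  induction l1; simpl; [easy |].
  now rewrite lsum_app, lsum_map, IHl1.
Qed.

Lemma lsum_le {A} (f g : A -> R) l : (forall x, f x <= g x) -> lsum f l <= lsum g l.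
Proof. intro h; induction l; simpl; [lra | specialize (h a); lra]. Qed.

(** The Cantor number of [(k, i)] is at least k + i, so the first [n] terms lie in the [n] by [n]
    square, whose sum is controlled row by row. *)
Lemma ex_series_cantor (f : nat -> nat -> R) (S : nat -> R) :
  (forall k i, 0 <= f k i) -> (forall k m, lsum (f k) (seq 0 m) <= S k) ->
  ex_series S -> ex_series (cantor_flatten f).
Proof.
  intros hf hS hs.
  assert (hS0 : forall k, 0 <= S k) by (intro k; apply (hS k 0%nat)).
  apply ex_series_bounded with (Series S); [intro; apply hf |].
  intro n; eapply Rle_trans; [| now apply (lsum_seq_le_Series S n)].
  change (lsum (cantor_flatten f) (seq 0 n)) with
    (lsum (fun m => (fun p => f (fst p) (snd p)) (of_nat m)) (seq 0 n)).
  rewrite <- (lsum_map of_nat (fun p => f (fst p) (snd p))).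
  apply Rle_trans with (lsum (fun p => f (fst p) (snd p)) (list_prod (seq 0 n) (seq 0 n))).
  - apply lsum_incl; [intro; apply hf | |].
    + apply FinFun.Injective_map_NoDup; [| apply seq_NoDup].
      intros x y e; rewrite <- (cancel_to_of x), <- (cancel_to_of y); now rewrite e.
    + intros [k i] h; apply in_map_iff in h; destruct h as (m & e & hm).
      apply in_seq in hm.
      pose proof (to_nat_non_decreasing k i) as hki.
      rewrite <- e, cancel_to_of in hki.
      apply in_prod; apply in_seq; lia.
  - rewrite lsum_list_prod; apply lsum_le; intro; apply hS.
Qed.

Lemma lsum_nth_error {A} (g : A -> R) l m : (forall x, In x l -> 0 <= g x) ->
  lsum (fun i => match nth_error l i with Some x => g x | None => 0 end) (seq 0 m) <= lsum g l.
Proof.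
  revert m; induction l as [| a l IH]; intros m hg.
  - eapply Rle_trans; [apply (lsum_le _ (fun _ => 0)) |].
    + intro i; destruct i; simpl; lra.
    + induction (seq 0 m); simpl in *; lra.
  - assert (h0 : 0 <= g a) by (apply hg; now left).
    specialize (fun m => IH m (fun x hx => hg x (or_intror hx))).
    destruct m; simpl.
    + specialize (IH 0%nat); simpl in IH; lra.
    + rewrite <- seq_shift, lsum_map; specialize (IH m); simpl; lra.
Qed.

(** * The pseudohyperbolic distance *)

Lemma Cmod_one_sub_conj_mul_sqr (z l : C) :
  Cmod (1 - Cconj l * z) ^ 2 = Cmod (z - l) ^ 2 + (1 - Cmod l ^ 2) * (1 - Cmod z ^ 2).
Proof. rewrite !Cmod_sqr; simpl; ring. Qed.

Lemma den_pos (z l : C) : disc z -> disc l -> 0 < Cmod (1 - Cconj l * z).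
Proof.
  unfold disc; intros hz hl; apply Cmod_gt_0, one_sub_mul_neq_0; [| easy].
  rewrite Cmod_conj; lra.
Qed.

Lemma rho_eq (z l : C) : disc z -> disc l ->
  rho z l = Cmod (z - l) / Cmod (1 - Cconj l * z).
Proof. intros hz hl; apply Cmod_div, Cmod_gt_0, den_pos; easy. Qed.

Lemma rho_nonneg z l : 0 <= rho z l.
Proof. apply Cmod_ge_0. Qed.

Lemma one_sub_rho_sqr (z l : C) : disc z -> disc l ->
  1 - rho z l ^ 2 = (1 - Cmod l ^ 2) * (1 - Cmod z ^ 2) / Cmod (1 - Cconj l * z) ^ 2.
Proof.
  intros hz hl; pose proof (den_pos z l hz hl).
  rewrite rho_eq by easy.
  replace ((1 - Cmod l ^ 2) * (1 - Cmod z ^ 2)) with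
    (Cmod (1 - Cconj l * z) ^ 2 - Cmod (z - l) ^ 2)
    by (rewrite Cmod_one_sub_conj_mul_sqr; ring).
  field; lra.
Qed.

Lemma disc_sqr z : disc z -> 0 < 1 - Cmod z ^ 2 <= 2 * (1 - Cmod z).
Proof. unfold disc; pose proof (Cmod_ge_0 z); split; nra. Qed.

Lemma rho_lt_1 (z l : C) : disc z -> disc l -> rho z l < 1.
Proof.
  intros hz hl; pose proof (one_sub_rho_sqr z l hz hl) as h.
  pose proof (den_pos z l hz hl).
  pose proof (disc_sqr z hz); pose proof (disc_sqr l hl).
  assert (0 < 1 - rho z l ^ 2).
  { rewrite h; apply Rdiv_lt_0_compat; nra. }
  pose proof (rho_nonneg z l); nra.
Qed.

Lemma rho_pos (z l : C) : disc z -> disc l -> z <> l -> 0 < rho z l.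
Proof.
  intros hz hl hzl; rewrite rho_eq by easy.
  apply Rdiv_lt_0_compat; [| now apply den_pos].
  apply Cmod_gt_0; intro e; apply hzl.
  replace z with (z - l + l)%C by ring; rewrite e; ring.
Qed.

Lemma rho_diag l : rho l l = 0.
Proof.
  unfold rho; replace ((l - l) / (1 - Cconj l * l))%C with (RtoC 0) by (unfold Cdiv; ring).
  apply Cmod_0.
Qed.

(** Twice the left side is ln (1 / x^2), and ln y <= y - 1. *)
Lemma neg_ln_le x : 0 < x -> - ln x <= (1 - x ^ 2) / (2 * x ^ 2).
Proof.
  intro hx.
  pose proof (exp_ineq1_le (- ln (x ^ 2))) as h.
  rewrite exp_Ropp, exp_ln in h by nra.
  replace (ln (x ^ 2)) with (2 * ln x) in h by (simpl; rewrite Rmult_1_r, ln_mult by easy; ring).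
  replace ((1 - x ^ 2) / (2 * x ^ 2)) with ((/ x ^ 2 - 1) / 2) by (field; nra); lra.
Qed.

Lemma neg_ln_le_of_sqr_ge x k : 0 < x < 1 -> 1 <= k * x ^ 2 -> - ln x <= k * (1 - x ^ 2).
Proof.
  intros hx hk; eapply Rle_trans; [now apply neg_ln_le |].
  assert (0 < x ^ 2 < 1) by nra.
  apply Rmult_le_reg_r with (2 * x ^ 2); [lra |].
  replace ((1 - x ^ 2) / (2 * x ^ 2) * (2 * x ^ 2)) with (1 - x ^ 2) by (field; nra).
  nra.
Qed.

Lemma Cmod_blaschke_factor l z : Cmod (blaschke_factor l z) = rho z l.
Proof.
  unfold blaschke_factor, rho; destruct (Ceq_dec l 0) as [-> | hl].
  - f_equal; replace (Cconj 0) with (RtoC 0) by (apply injective_projections; simpl; ring).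
    field.
  - assert (h : 0 < Cmod l) by now apply Cmod_gt_0.
    rewrite Cmod_mult, Cmod_div, Cmod_conj, Cmod_R, Rabs_pos_eq
      by (lra || (intro e; apply RtoC_inj in e; lra)).
    replace (Cmod l / Cmod l) with 1 by (field; lra).
    rewrite Rmult_1_l, <- Cmod_opp; f_equal; unfold Cdiv; ring.
Qed.

(** For l <> 0 the normalization conj(l) / |l| makes 1 minus the factor divisible by 1 - |l|: it
    equals (1 - |l|) (1 + conj(l) z / |l|) / (1 - conj(l) z). Hence the partial products have
    summable steps. *)
Lemma Cmod_one_sub_blaschke_factor l z : disc l -> disc z ->
  Cmod (1 - blaschke_factor l z) <= 2 / (1 - Cmod z) * (1 - Cmod l).
Proof.
  intros hl hz; unfold disc in *.
  pose proof (Cmod_ge_0 z) as hz0. pose proof (Cmod_ge_0 l) as hl0.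
  unfold blaschke_factor; destruct (Ceq_dec l 0) as [-> | hl1].
  - rewrite Cmod_0; eapply Rle_trans; [apply Cmod_triangle |].
    rewrite Cmod_opp, Cmod_1.
    apply Rmult_le_reg_r with (1 - Cmod z); [lra |].
    replace (2 / (1 - Cmod z) * (1 - 0) * (1 - Cmod z)) with 2 by (field; lra); nra.
  - assert (h : 0 < Cmod l) by now apply Cmod_gt_0.
    assert (hlr : RtoC (Cmod l) <> 0) by (intro e; apply RtoC_inj in e; lra).
    assert (hd : (1 - Cconj l * z)%C <> 0) by (apply one_sub_mul_neq_0; [rewrite Cmod_conj; lra | easy]).
    assert (e0 : (l * Cconj l)%C = (RtoC (Cmod l) * RtoC (Cmod l))%C).
    { rewrite <- Cmod2_conj; simpl; rewrite Rmult_1_r, RtoC_mult; easy. }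
    assert (e : (1 - Cconj l / RtoC (Cmod l) * ((l - z) / (1 - Cconj l * z)) =
      RtoC (1 - Cmod l) * (1 + Cconj l / RtoC (Cmod l) * z) / (1 - Cconj l * z))%C).
    { rewrite RtoC_minus.
      transitivity ((1 - Cconj l * z - (l * Cconj l) / RtoC (Cmod l) +
         Cconj l / RtoC (Cmod l) * z) / (1 - Cconj l * z))%C; [field; auto |].
      rewrite e0; field; auto. }
    rewrite e, Cmod_div, Cmod_mult, Cmod_R, Rabs_pos_eq by (easy || lra).
    assert (h1 : Cmod (1 + Cconj l / RtoC (Cmod l) * z) <= 2).
    { eapply Rle_trans; [apply Cmod_triangle |].
      rewrite Cmod_1, Cmod_mult, Cmod_div, Cmod_conj, Cmod_R, Rabs_pos_eq by (easy || lra).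
      replace (Cmod l / Cmod l) with 1 by (field; lra); lra. }
    assert (h2 : 1 - Cmod z <= Cmod (1 - Cconj l * z)).
    { apply Cmod_one_sub_mul_ge; [rewrite Cmod_conj; lra | lra]. }
    replace (2 / (1 - Cmod z) * (1 - Cmod l)) with ((1 - Cmod l) * 2 * / (1 - Cmod z)) by (field; lra).
    apply Rmult_le_compat.
    + apply Rmult_le_pos; [lra | apply Cmod_ge_0].
    + left; apply Rinv_0_lt_compat; lra.
    + apply Rmult_le_compat_l; lra.
    + apply Rinv_le_contravar; lra.
Qed.

(** The hypothesis gives 1 - |z| <= (k + 1) |z - p| as well, so |1 - conj(p) z|^2 exceeds |z - p|^2
    by at most 4 k (k + 1) |z - p|^2. *)
Lemma rho_sqr_ge (z p : C) k : disc z -> disc p -> 0 < k ->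
  1 - Cmod p <= k * Cmod (z - p) -> 1 <= (1 + 4 * k ^ 2 + 4 * k) * rho z p ^ 2.
Proof.
  intros hz hp hk h.
  pose proof (den_pos z p hz hp) as hd. rewrite rho_eq by easy.
  pose proof (Cmod_one_sub_conj_mul_sqr z p) as hs.
  set (D := Cmod (1 - Cconj p * z)) in *. set (d := Cmod (z - p)) in *.
  destruct (disc_sqr z hz) as [hz1 hz2]. destruct (disc_sqr p hp) as [hp1 hp2].
  assert (hzd : 1 - Cmod z <= (1 - Cmod p) + d).
  { pose proof (Cmod_triangle_inv' z p) as ht; unfold d; lra. }
  unfold disc in hp.
  assert (hd0 : 0 <= d) by apply Cmod_ge_0.
  assert ((1 - Cmod p ^ 2) * (1 - Cmod z ^ 2) <= (2 * (k * d)) * (2 * (k * d + d))).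
  { apply Rmult_le_compat; lra. }
  apply Rmult_le_reg_r with (D ^ 2); [nra |].
  replace ((1 + 4 * k ^ 2 + 4 * k) * (d / D) ^ 2 * D ^ 2) with ((1 + 4 * k ^ 2 + 4 * k) * d ^ 2)
    by (field; lra).
  rewrite hs; nra.
Qed.

(** If x <= y / 8 are the distances of the two points to the circle, then |z - p| >= 7 y / 8, and
    the excess of |1 - conj(p) z|^2 over |z - p|^2, at most 4 x y, is below 3 |z - p|^2. This is
    what separates clusters of different scales. *)
Lemma rho_ge_half (z p : C) : disc z -> disc p ->
  (1 - Cmod z <= (1 - Cmod p) / 8 \/ 1 - Cmod p <= (1 - Cmod z) / 8) -> / 2 <= rho z p.
Proof.
  intros hz hp h.
  pose proof (den_pos z p hz hp) as hd.
  pose proof (Cmod_one_sub_conj_mul_sqr z p) as hs.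
  rewrite rho_eq by easy.
  set (D := Cmod (1 - Cconj p * z)) in *. set (d := Cmod (z - p)) in *.
  destruct (disc_sqr z hz) as [hz1 hz2]. destruct (disc_sqr p hp) as [hp1 hp2].
  pose proof (Cmod_triangle_inv' z p) as ht; fold d in ht.
  pose proof (Cmod_triangle_inv z p) as ht'; fold d in ht'.
  assert (hd0 : 0 <= d) by apply Cmod_ge_0.
  unfold disc in *.
  set (x := 1 - Cmod z) in *. set (y := 1 - Cmod p) in *.
  assert (hx : 0 < x) by (unfold x; lra). assert (hy : 0 < y) by (unfold y; lra).
  assert (hxy : y - x <= d /\ x - y <= d) by (unfold x, y; lra).
  assert ((1 - Cmod p ^ 2) * (1 - Cmod z ^ 2) <= (2 * y) * (2 * x)).
  { apply Rmult_le_compat; lra. }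
  assert (D ^ 2 <= (2 * d) ^ 2) by (destruct h; nra).
  assert (D <= 2 * d) by nra.
  apply Rmult_le_reg_r with D; [easy |].
  unfold Rdiv; rewrite Rmult_assoc, Rinv_l by lra; lra.
Qed.

(** * Blaschke products *)

Section BlaschkeProduct.

Variable a : nat -> option C.
Hypothesis ha : blaschke_sequence a.

Definition zero_weight (n : nat) : R :=
  match a n with Some l => 1 - Cmod l | None => 0 end.
Definition rho_at (n : nat) (z : C) : R :=
  match a n with Some l => rho z l | None => 1 end.

Definition blaschke_product (z : C) : C :=
  (real (Lim_seq (fun n => fst (blaschke_partial a n z))),
   real (Lim_seq (fun n => snd (blaschke_partial a n z)))).

Lemma rho_at_bounds n z : disc z -> 0 <= rho_at n z <= 1.
Proof.
  intro hz; unfold rho_at; destruct (a n) as [l |] eqn:e; [| lra].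
  split; [apply rho_nonneg | left; apply rho_lt_1; [easy | now apply (proj1 ha n)]].
Qed.

Lemma Cmod_blaschke_partial_S n z :
  Cmod (blaschke_partial a (S n) z) = Cmod (blaschke_partial a n z) * rho_at n z.
Proof.
  simpl; rewrite Cmod_mult; f_equal; unfold rho_at.
  destruct (a n); [apply Cmod_blaschke_factor | apply Cmod_1].
Qed.

Lemma Cmod_blaschke_partial_le_1 n z : disc z -> Cmod (blaschke_partial a n z) <= 1.
Proof.
  intro hz; induction n; [simpl; rewrite Cmod_1; lra |].
  rewrite Cmod_blaschke_partial_S; pose proof (rho_at_bounds n z hz).
  pose proof (Cmod_ge_0 (blaschke_partial a n z)); nra.
Qed.

Lemma blaschke_partial_step n z : disc z ->
  Cmod (blaschke_partial a (S n) z - blaschke_partial a n z) <= 2 / (1 - Cmod z) * zero_weight n.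
Proof.
  intro hz; simpl.
  set (F := match a n with Some l => blaschke_factor l z | None => 1%C end).
  replace (blaschke_partial a n z * F - blaschke_partial a n z)%C with
    (- (blaschke_partial a n z * (1 - F)))%C by ring.
  rewrite Cmod_opp, Cmod_mult.
  apply Rle_trans with (1 * Cmod (1 - F)).
  - apply Rmult_le_compat_r; [apply Cmod_ge_0 | now apply Cmod_blaschke_partial_le_1].
  - rewrite Rmult_1_l; unfold F, zero_weight; destruct (a n) as [l |] eqn:e.
    + apply Cmod_one_sub_blaschke_factor; [now apply (proj1 ha n) | easy].
    + replace (1 - 1)%C with (RtoC 0) by ring; rewrite Cmod_0; lra.
Qed.

Lemma lim_of_summable_steps (p : nat -> R) (w : nat -> R) k :
  (forall n, Rabs (p (S n) - p n) <= k * w n) -> ex_series w ->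
  is_lim_seq p (Lim_seq p) /\ is_finite (Lim_seq p).
Proof.
  intros h hw.
  assert (hs : ex_series (fun n => p (S n) - p n)).
  { apply (@ex_series_le R_AbsRing R_CompleteNormedModule) with (fun n => k * w n); [exact h |].
    now apply (ex_series_scal_l k w). }
  destruct hs as [L hL].
  assert (E : forall n, sum_n (fun n => p (S n) - p n) n = p (S n) - p 0%nat).
  { induction n; [now rewrite sum_O |]. rewrite sum_Sn, IHn; unfold plus; simpl; ring. }
  assert (hp : is_lim_seq p (L + p 0%nat)).
  { apply is_lim_seq_incr_1.
    apply is_lim_seq_ext with (fun n => sum_n (fun n => p (S n) - p n) n + p 0%nat).
    - intro n; rewrite E; ring.
    - apply is_lim_seq_plus'; [exact hL | apply is_lim_seq_const]. }
  rewrite (is_lim_seq_unique _ _ hp); now split.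
Qed.

Lemma blaschke_product_lim z : disc z ->
  filterlim (fun n => blaschke_partial a n z) eventually (locally (blaschke_product z)).
Proof.
  intro hz.
  assert (hs := fun n => blaschke_partial_step n z hz).
  destruct (lim_of_summable_steps (fun n => fst (blaschke_partial a n z)) zero_weight
    (2 / (1 - Cmod z))) as [h1 f1]; [| apply ha |].
  { intro n; eapply Rle_trans; [| apply hs].
    eapply Rle_trans; [| apply Rmax_Cmod]; apply Rmax_l. }
  destruct (lim_of_summable_steps (fun n => snd (blaschke_partial a n z)) zero_weight
    (2 / (1 - Cmod z))) as [h2 f2]; [| apply ha |].
  { intro n; eapply Rle_trans; [| apply hs].
    eapply Rle_trans; [| apply Rmax_Cmod]; apply Rmax_r. }
  rewrite <- f1 in h1; rewrite <- f2 in h2.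
  intros P [e he].
  assert (l1 := h1 _ (locally_ball _ e)); assert (l2 := h2 _ (locally_ball _ e)).
  apply (filter_imp _ _ (fun n (hn : _ /\ _) => he _ hn)).
  now apply filter_and.
Qed.

Lemma is_blaschke_product_intro : is_blaschke_product blaschke_product.
Proof. exists a; split; [exact ha | exact blaschke_product_lim]. Qed.

Lemma Cmod_blaschke_product_lim z : disc z ->
  is_lim_seq (fun n => Cmod (blaschke_partial a n z)) (Cmod (blaschke_product z)).
Proof.
  intro hz; apply is_lim_seq_spec; intro e; pose proof (cond_pos e).
  assert (he : 0 < e / 2) by lra.
  apply (filter_imp (fun n => @ball (prod_UniformSpace R_UniformSpace R_UniformSpace)
    (blaschke_product z) (mkposreal _ he) (blaschke_partial a n z)));
    [| exact (blaschke_product_lim z hz _ (locally_ball _ (mkposreal _ he)))].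
  intros n [b1 b2].
  set (p := blaschke_partial a n z) in *. set (B := blaschke_product z) in *.
  assert (hc : Cmod (p - B) < e).
  { change (p - B)%C with (fst p - fst B, snd p - snd B).
    eapply Rle_lt_trans; [apply Cmod_pair_le |].
    change (Rabs (fst p - fst B) < e / 2) in b1; change (Rabs (snd p - snd B) < e / 2) in b2.
    lra. }
  pose proof (Cmod_triangle_inv p B).
  pose proof (Cmod_triangle_inv' p B).
  apply Rabs_def1; lra.
Qed.

Lemma Cmod_blaschke_product_le n z : disc z ->
  Cmod (blaschke_product z) <= Cmod (blaschke_partial a n z).
Proof.
  intro hz.
  apply (is_lim_seq_decr_compare (fun n => Cmod (blaschke_partial a n z))).
  - now apply Cmod_blaschke_product_lim.
  - intro m; rewrite Cmod_blaschke_partial_S; pose proof (rho_at_bounds m z hz).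
    pose proof (Cmod_ge_0 (blaschke_partial a m z)); nra.
Qed.

Lemma blaschke_product_zero n l : a n = Some l -> zero_set blaschke_product l.
Proof.
  intro e; assert (hl : disc l) by now apply (proj1 ha n).
  split; [easy |]; apply Cmod_eq_0.
  apply Rle_antisym; [| apply Cmod_ge_0].
  eapply Rle_trans; [now apply (Cmod_blaschke_product_le (S n)) |].
  rewrite Cmod_blaschke_partial_S; unfold rho_at; rewrite e, rho_diag; lra.
Qed.

Lemma Cmod_blaschke_partial_exp n z : (forall i, 0 < rho_at i z) ->
  Cmod (blaschke_partial a n z) = exp (- lsum (fun i => - ln (rho_at i z)) (seq 0 n)).
Proof.
  intro h; induction n; [simpl; rewrite Cmod_1, Ropp_0, exp_0; easy |].
  rewrite Cmod_blaschke_partial_S, IHn, seq_S, lsum_app; simpl.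
  rewrite Ropp_plus_distr, exp_plus; f_equal.
  replace (- (- ln (rho_at n z) + 0)) with (ln (rho_at n z)) by ring.
  now rewrite exp_ln.
Qed.

Lemma blaschke_product_lower z (V : nat -> R) : disc z ->
  (forall i, 0 < rho_at i z) -> (forall i, - ln (rho_at i z) <= V i) -> ex_series V ->
  exp (- Series V) <= Cmod (blaschke_product z).
Proof.
  intros hz hpos hV hs.
  assert (hV0 : forall i, 0 <= V i).
  { intro i; eapply Rle_trans; [| apply hV].
    destruct (rho_at_bounds i z hz) as [_ h1].
    pose proof (ln_le _ _ (hpos i) h1); rewrite ln_1 in H; lra. }
  apply (is_lim_seq_le (fun _ => exp (- Series V)) (fun n => Cmod (blaschke_partial a n z))
    (exp (- Series V)) (Cmod (blaschke_product z))).
  - intro n; rewrite Cmod_blaschke_partial_exp by easy.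
    assert (lsum (fun i => - ln (rho_at i z)) (seq 0 n) <= Series V).
    { eapply Rle_trans; [apply lsum_le, hV | now apply lsum_seq_le_Series]. }
    destruct (Rle_lt_or_eq_dec _ _ H) as [hl | he]; [left; apply exp_increasing; lra | right; f_equal; lra].
  - apply is_lim_seq_const.
  - now apply Cmod_blaschke_product_lim.
Qed.

Lemma zero_weight_nonneg n : 0 <= zero_weight n.
Proof.
  unfold zero_weight; destruct (a n) eqn:e; [| lra].
  pose proof (proj1 ha n _ e) as h; unfold disc in h; lra.
Qed.

(** If [z] differs from every term of the sequence, all the -ln rho are finite and from some index
    on at most a multiple of 1 - |l|; their sum converges and bounds |B z| below by a positive
    number. *)
Lemma zero_set_blaschke_product z : zero_set blaschke_product z -> exists n, a n = Some z.
Proof.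
  intros [hz h0]; apply NNPP; intro hn.
  assert (hpos : forall i, 0 < rho_at i z).
  { intro i; unfold rho_at; destruct (a i) as [l |] eqn:e; [| lra].
    apply rho_pos; [easy | now apply (proj1 ha i) |].
    intros ->; apply hn; now exists i. }
  assert (hs : ex_series (fun i => - ln (rho_at i z))).
  { set (k := 4 / (1 - Cmod z) ^ 2).
    unfold disc in hz; pose proof (Cmod_ge_0 z) as hz0.
    assert (hk : 0 < k) by (apply Rdiv_lt_0_compat; nra).
    assert (hr : forall i, 1 - rho_at i z ^ 2 <= k * zero_weight i).
    { intro i; unfold rho_at, zero_weight; destruct (a i) as [l |] eqn:e; [| simpl; lra].
      assert (hl : disc l) by now apply (proj1 ha i).
      rewrite one_sub_rho_sqr by easy.
      destruct (disc_sqr z hz) as [hz1 hz2]; destruct (disc_sqr l hl) as [hl1 hl2].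
      assert (hd : 1 - Cmod z <= Cmod (1 - Cconj l * z)).
      { apply Cmod_one_sub_mul_ge; [rewrite Cmod_conj; unfold disc in hl; lra | lra]. }
      replace (k * (1 - Cmod l)) with (2 * (1 - Cmod l) * 2 * / (1 - Cmod z) ^ 2)
        by (unfold k; field; lra).
      unfold disc in hl.
      apply Rmult_le_compat; [nra | left; apply Rinv_0_lt_compat; nra | nra |].
      apply Rinv_le_contravar; nra. }
    pose proof (ex_series_lim_0 _ (proj2 ha)) as hlim; fold zero_weight in hlim.
    apply is_lim_seq_spec in hlim.
    (* Once [zero_weight] is below 1 / (2 k), one has rho^2 >= 1 / 2 and therefore -ln rho <= 1 -
       rho^2. *)
    assert (hk2 : 0 < / (2 * k)) by (apply Rinv_0_lt_compat; lra).
    destruct (hlim (mkposreal _ hk2)) as [N hN]; simpl in hN.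
    apply (ex_series_incr_n _ N).
    apply (@ex_series_le R_AbsRing R_CompleteNormedModule) with
      (fun i => 2 * k * zero_weight (N + i)).
    - intro i; unfold norm; simpl; unfold abs; simpl.
      destruct (rho_at_bounds (N + i) z hz) as [b0 b1]; specialize (hpos (N + i)%nat).
      pose proof (ln_le _ _ hpos b1) as hl; rewrite ln_1 in hl.
      rewrite Rabs_pos_eq by lra.
      specialize (hN (N + i)%nat ltac:(lia)); specialize (hr (N + i)%nat).
      rewrite Rminus_0_r in hN; pose proof (Rle_abs (zero_weight (N + i))) as ha'.
      unfold zero_weight in hN, ha', hr |- *.
      set (w := match a (N + i)%nat with Some l => 1 - Cmod l | None => 0 end) in *.
      set (x := rho_at (N + i) z) in *.
      assert (hw : k * w <= / 2).
      { replace (/ 2) with (k * / (2 * k)) by (field; lra). apply Rmult_le_compat_l; lra. }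
      eapply Rle_trans; [now apply neg_ln_le |].
      apply Rmult_le_reg_r with (2 * x ^ 2); [nra |].
      replace ((1 - x ^ 2) / (2 * x ^ 2) * (2 * x ^ 2)) with (1 - x ^ 2) by (field; nra).
      assert (0 <= k * w) by nra. nra.
    - apply (ex_series_scal_l (2 * k) (fun i => zero_weight (N + i))).
      now apply (ex_series_incr_n zero_weight N), (proj2 ha). }
  pose proof (blaschke_product_lower z _ hz hpos (fun i => Rle_refl _) hs) as hB.
  rewrite h0, Cmod_0 in hB.
  pose proof (exp_pos (- Series (fun i => - ln (rho_at i z)))); lra.
Qed.

(* A zero [l] contributes [K (1 - rho(z,l)^2)], which is at most a constant times
   [(1 - |l|) Re ((1 + conj l z) / (1 - conj l z))], a positive harmonic function of [z]. *)
Lemma blaschke_harmonic_majorant (K : nat -> R) :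
  (forall i, 0 <= K i) -> ex_series (fun i => K i * zero_weight i) ->
  exists H1, Har_pos H1 /\ forall z, disc z ->
    (forall i, 0 < rho_at i z /\ - ln (rho_at i z) <= K i * (1 - rho_at i z ^ 2)) ->
    - ln (Cmod (blaschke_product z)) <= H1 z.
Proof.
  intros hK hs.
  set (b := fun i => match a i with Some l => Cconj l | None => 0%C end).
  assert (hb : forall i, Cmod (b i) <= 1).
  { intro i; unfold b; destruct (a i) as [l |] eqn:e; [| rewrite Cmod_0; lra].
    rewrite Cmod_conj; left; now apply (proj1 ha i). }
  set (W := fun i => 2 * (K i * zero_weight i)).
  assert (hW : ex_series W) by now apply (ex_series_scal_l 2 (fun i => K i * zero_weight i)).
  assert (hW0 : forall i, 0 <= W i).
  { intro i; unfold W; pose proof (zero_weight_nonneg i).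
    apply Rmult_le_pos; [lra | now apply Rmult_le_pos]. }
  assert (hc : summable (fun i => RtoC (2 * W i))).
  { apply ex_series_ext with (fun i => 2 * W i); [| now apply (ex_series_scal_l 2 W)].
    intro i; rewrite Cmod_R, Rabs_pos_eq; [easy | specialize (hW0 i); lra]. }
  set (g := fun i z => 2 * Re (/ (1 - b i * z)) - 1).
  (* This is 1 plus the series of W_i Re ((1 + b_i z) / (1 - b_i z)); the added 1 ensures strict
     positivity even if all weights vanish. *)
  exists (fun z => (1 - Series W) + cauchy_series b 1 (fun i => RtoC (2 * W i)) z).
  assert (hser : forall z, disc z -> ex_series (fun i => W i * g i z) /\
    (1 - Series W) + cauchy_series b 1 (fun i => RtoC (2 * W i)) z = 1 + Series (fun i => W i * g i z)).
  { intros z hz.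
    pose proof (ex_cauchy_series b hb 1 _ z hc hz) as e1.
    assert (E : forall i, cauchy_term b 1 (fun i => RtoC (2 * W i)) z i - W i = W i * g i z).
    { intro i; unfold cauchy_term, g.
      replace ((/ (1 - b i * z)) ^ 1)%C with (/ (1 - b i * z))%C by (simpl; ring).
      unfold Re, RtoC, Cmult; simpl fst; simpl snd; ring. }
    split.
    - apply ex_series_ext with (1 := E).
      apply (ex_series_minus _ W e1 hW).
    - rewrite <- (Series_ext _ _ E), Series_minus by easy; unfold cauchy_series; ring. }
  assert (hg : forall i z, disc z -> 1 - rho_at i z ^ 2 <= 2 * zero_weight i * g i z /\ 0 <= g i z).
  { intros i z hz.
    assert (hden : 0 < Cmod (1 - b i * z)) by now apply Cmod_gt_0, one_sub_mul_neq_0.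
    assert (eg : g i z = (1 - Cmod (b i) ^ 2 * Cmod z ^ 2) / Cmod (1 - b i * z) ^ 2).
    { unfold g; rewrite Re_inv by now apply Cmod_gt_0.
      rewrite <- Cmod_sqr.
      transitivity ((2 * Re (1 - b i * z) - Cmod (1 - b i * z) ^ 2) / Cmod (1 - b i * z) ^ 2);
        [field; lra |].
      f_equal; rewrite !Cmod_sqr; unfold Re; simpl; ring. }
    destruct (disc_sqr z hz) as [hz1 hz2].
    assert (hbi := hb i). assert (hb0 := Cmod_ge_0 (b i)).
    assert (hnum : 1 - Cmod z ^ 2 <= 1 - Cmod (b i) ^ 2 * Cmod z ^ 2).
    { assert (Cmod (b i) ^ 2 <= 1) by nra. pose proof (pow2_ge_0 (Cmod z)); nra. }
    assert (hinv : 0 < / Cmod (1 - b i * z) ^ 2) by (apply Rinv_0_lt_compat; nra).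
    assert (hg0 : 0 <= g i z) by (rewrite eg; unfold Rdiv; nra).
    split; [| easy].
    unfold rho_at, zero_weight; destruct (a i) as [l |] eqn:e; [| simpl; lra].
    assert (hl : disc l) by now apply (proj1 ha i).
    destruct (disc_sqr l hl) as [hl1 hl2].
    rewrite one_sub_rho_sqr by easy.
    assert (ebl : b i = Cconj l) by (unfold b; now rewrite e).
    rewrite eg, <- ebl; unfold Rdiv; rewrite <- !Rmult_assoc.
    apply Rmult_le_compat_r; [lra |].
    apply Rmult_le_compat; lra. }
  split; [split |].
  - now apply cauchy_series_harmonic.
  - intros z hz; destruct (hser z hz) as [e1 ->].
    assert (0 <= Series (fun i => W i * g i z)); [| lra].
    apply Series_nonneg; [| easy]; intro i; apply Rmult_le_pos; [easy | now apply hg].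
  - intros z hz h; destruct (hser z hz) as [e1 ->].
    assert (hB : exp (- Series (fun i => W i * g i z)) <= Cmod (blaschke_product z)).
    { apply blaschke_product_lower; try easy; [intro i; apply h |].
      intro i; destruct (h i) as [_ h2]; eapply Rle_trans; [exact h2 |].
      unfold W; replace (2 * (K i * zero_weight i) * g i z) with
        (K i * (2 * zero_weight i * g i z)) by ring.
      apply Rmult_le_compat_l; [easy | now apply hg]. }
    pose proof (ln_le _ _ (exp_pos _) hB) as hln; rewrite ln_exp in hln; lra.
Qed.

(** The factors not indexed by [L] have modulus at most 1 and can only increase the right side. *)
Lemma neg_ln_blaschke_product_ge z l L : disc z -> blaschke_product z <> 0 ->
  NoDup L -> (forall i, In i L -> a i = Some l) ->
  INR (length L) * - ln (rho z l) <= - ln (Cmod (blaschke_product z)).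
Proof.
  intros hz hB hd hL.
  assert (hpos : forall i, 0 < rho_at i z).
  { intro i; unfold rho_at; destruct (a i) as [p |] eqn:e; [| lra].
    apply rho_pos; [easy | now apply (proj1 ha i) |].
    intros ->; apply hB; now apply (blaschke_product_zero i p). }
  set (n := S (list_max L)).
  pose proof (Cmod_blaschke_product_le n z hz) as hle.
  rewrite Cmod_blaschke_partial_exp in hle by easy.
  apply ln_le in hle; [| now apply Cmod_gt_0].
  rewrite ln_exp in hle.
  assert (h0 : forall i, 0 <= - ln (rho_at i z)).
  { intro i; destruct (rho_at_bounds i z hz) as [_ h1].
    pose proof (ln_le _ _ (hpos i) h1); rewrite ln_1 in H; lra. }
  assert (lsum (fun i => - ln (rho_at i z)) L <= lsum (fun i => - ln (rho_at i z)) (seq 0 n)).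
  { apply lsum_incl; try easy; intros i hi; apply in_seq; unfold n.
    assert (i <= list_max L)%nat; [| lia].
    pose proof (proj1 (list_max_le L (list_max L)) (Nat.le_refl _)) as hm.
    rewrite Forall_forall in hm; now apply hm. }
  assert (INR (length L) * - ln (rho z l) <= lsum (fun i => - ln (rho_at i z)) L); [| lra].
  apply lsum_ge_length; intros i hi; unfold rho_at; rewrite (hL i hi); lra.
Qed.

End BlaschkeProduct.

(** * Grids of zeros *)

(** The shift by [N] centers the square at [l], which is itself the grid point of index [(N, N)]. *)
Definition grid_point (l : C) (e : R) (N : nat) (ij : nat * nat) : C :=
  (l + (((1 - Cmod l) * e * (INR (fst ij) - INR N))%R,
        ((1 - Cmod l) * e * (INR (snd ij) - INR N))%R))%C.

Definition grid (l : C) (e : R) (N : nat) : list C :=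
  map (grid_point l e N) (list_prod (seq 0 (2 * N + 1)) (seq 0 (2 * N + 1))).

Lemma nat_floor x : 0 <= x -> exists n : nat, INR n <= x < INR n + 1.
Proof.
  intro hx; destruct (nfloor_ex x hx) as [n hn]; now exists n.
Qed.

Section Grid.

(** In units of s = 1 - |l| the grid has step [e] and half-side N e. The lower bound d / 8 lets it
    cover the disc of radius (d / 8) s about [l]; the upper bound d / 4 keeps it within (d / 2) s of
    [l]. *)
Variables (l : C) (e d : R) (N : nat).
Hypotheses (hl : disc l) (hd : 0 < d <= / 16) (he : 0 < e) (hN : d / 8 <= INR N * e <= d / 4).
Let s := 1 - Cmod l.

Lemma grid_s_pos : 0 < s.
Proof. unfold s; unfold disc in hl; lra. Qed.

Lemma near_bounds p k : Cmod (p - l) <= k * s -> s * (1 - k) <= 1 - Cmod p <= s * (1 + k).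
Proof.
  intro h; pose proof (Cmod_triangle_inv p l); pose proof (Cmod_triangle_inv' p l).
  unfold s in *; lra.
Qed.

Lemma grid_near p : In p (grid l e N) -> Cmod (p - l) <= d / 2 * s.
Proof.
  intro hp; apply in_map_iff in hp; destruct hp as ([i j] & <- & hij).
  apply in_prod_iff in hij; destruct hij as [hi hj]; apply in_seq in hi; apply in_seq in hj.
  unfold grid_point; simpl fst; simpl snd; fold s.
  replace (l + _ - l)%C with ((s * e * (INR i - INR N))%R, (s * e * (INR j - INR N))%R)
    by (apply injective_projections; simpl; ring).
  assert (hb : forall i, (0 <= i < 0 + (2 * N + 1))%nat -> Rabs (INR i - INR N) <= INR N).
  { intros k hk; apply Rabs_le.
    assert (INR k <= INR (2 * N)) by (apply le_INR; lia).
    rewrite mult_INR in H; simpl in H; pose proof (pos_INR k); lra. }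
  pose proof grid_s_pos as hs.
  assert (hse : 0 < s * e) by nra.
  eapply Rle_trans; [apply Cmod_pair_le |].
  rewrite !(Rabs_mult (s * e)), !(Rabs_pos_eq (s * e)) by lra.
  pose proof (hb i hi); pose proof (hb j hj).
  assert (s * e * Rabs (INR i - INR N) <= s * e * INR N) by (apply Rmult_le_compat_l; lra).
  assert (s * e * Rabs (INR j - INR N) <= s * e * INR N) by (apply Rmult_le_compat_l; lra).
  assert (s * (INR N * e) <= s * (d / 4)) by (apply Rmult_le_compat_l; lra).
  lra.
Qed.

Lemma grid_disc p : In p (grid l e N) -> disc p.
Proof.
  intro hp; apply grid_near, near_bounds in hp; pose proof grid_s_pos; unfold disc; nra.
Qed.

Lemma one_sub_conj_ge z p : disc z -> disc p -> 1 - Cmod p <= Cmod (1 - Cconj p * z).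
Proof.
  intros hz hp; unfold disc in *.
  eapply Rle_trans; [| apply Cmod_triangle_inv].
  rewrite Cmod_1, Cmod_mult, Cmod_conj; pose proof (Cmod_ge_0 p); nra.
Qed.

Lemma rho_le z p k : disc z -> disc p -> Cmod (z - p) <= k * (1 - Cmod p) -> rho z p <= k.
Proof.
  intros hz hp h; rewrite rho_eq by easy.
  pose proof (one_sub_conj_ge z p hz hp); pose proof (den_pos z p hz hp).
  apply Rmult_le_reg_r with (Cmod (1 - Cconj p * z)); [easy |].
  unfold Rdiv; rewrite Rmult_assoc, Rinv_l by lra.
  unfold disc in hp; pose proof (Cmod_ge_0 (z - p)).
  assert (0 <= k) by (destruct (Rle_dec 0 k); [easy | nra]). nra.
Qed.

(** Rounding both coordinates down leads to a grid point [p] within 2 s e of [z], and 1 - |p| >= 2 s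
    / 3, so that [rho] is at most 3 e. *)
Lemma grid_cover z : disc z -> Cmod (z - l) <= d / 8 * s ->
  exists p, In p (grid l e N) /\ rho z p < 4 * e.
Proof.
  intros hz hzl.
  pose proof grid_s_pos as hs. assert (hse : 0 < s * e) by nra.
  assert (hco : forall x, Rabs x <= d / 8 * s -> exists i : nat, (i < 2 * N + 1)%nat /\
    Rabs (x - s * e * (INR i - INR N)) <= s * e).
  { intros x hx.
    assert (hX : Rabs (x / (s * e)) <= INR N).
    { unfold Rdiv; rewrite Rabs_mult, Rabs_inv, (Rabs_pos_eq (s * e)) by lra.
      apply Rmult_le_reg_r with (s * e); [easy |].
      rewrite Rmult_assoc, Rinv_l, Rmult_1_r by lra; nra. }
    pose proof (proj1 (Rabs_le_between _ _) hX) as hX2.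
    destruct (nat_floor (x / (s * e) + INR N)) as [i hi]; [lra |].
    exists i; split.
    - apply INR_lt; rewrite plus_INR, mult_INR; simpl; lra.
    - replace (x - s * e * (INR i - INR N)) with (s * e * (x / (s * e) + INR N - INR i))
        by (field; split; lra).
      rewrite Rabs_mult, (Rabs_pos_eq (s * e)), Rabs_pos_eq by lra; nra. }
  pose proof (Rmax_Cmod (z - l)%C) as hm.
  destruct (hco (fst (z - l)%C)) as (i & hi & hxi).
  { eapply Rle_trans; [apply Rmax_l |]; eapply Rle_trans; eassumption. }
  destruct (hco (snd (z - l)%C)) as (j & hj & hyj).
  { eapply Rle_trans; [apply Rmax_r |]; eapply Rle_trans; eassumption. }
  assert (hin : In (grid_point l e N (i, j)) (grid l e N)).
  { apply in_map, in_prod; apply in_seq; lia. }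
  exists (grid_point l e N (i, j)); split; [easy |].
  apply Rle_lt_trans with (3 * e); [| lra].
  apply rho_le; [easy | now apply grid_disc |].
  pose proof (near_bounds _ _ (grid_near _ hin)) as hb.
  replace (z - grid_point l e N (i, j))%C with
    ((fst (z - l)%C - s * e * (INR i - INR N))%R, (snd (z - l)%C - s * e * (INR j - INR N))%R)
    by (apply injective_projections; unfold grid_point, s; simpl; ring).
  eapply Rle_trans; [apply Cmod_pair_le |].
  assert (2 * s <= 3 * (1 - Cmod (grid_point l e N (i, j)))) by nra.
  nra.
Qed.

(** Half a step to the right of [l]: its real part is off every column of the grid by at least half
    a step, yet it is very close to the multiple zero [l]. *)
Definition test_point : C := (l + ((1 - Cmod l) * e / 2)%R)%C.

Lemma test_point_near : e <= d -> Cmod (test_point - l) = s * e / 2 /\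
  Cmod (test_point - l) <= d / 2 * s /\ disc test_point.
Proof.
  intro hed.
  pose proof grid_s_pos as hs.
  assert (E : Cmod (test_point - l) = s * e / 2).
  { unfold test_point; fold s; replace (l + RtoC (s * e / 2) - l)%C with (RtoC (s * e / 2)) by ring.
    rewrite Cmod_R, Rabs_pos_eq; [easy | nra]. }
  assert (hle : Cmod (test_point - l) <= d / 2 * s) by (rewrite E; nra).
  refine (conj E (conj hle _)).
  apply near_bounds in hle; unfold disc; nra.
Qed.

Lemma test_point_rho_center : e <= d -> rho test_point l <= e / 2.
Proof.
  intro hed; destruct (test_point_near hed) as (h1 & _ & h3).
  apply rho_le; [easy | easy |]; rewrite h1; fold s; lra.
Qed.

(** Comparing real parts gives a distance of at least s e / 2 to each grid point; the denominator of
    [rho] is at most 3 s, because 1 - conj(p) z = (1 - |p|^2) + conj(p) (p - z). *)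
Lemma test_point_rho_grid p : e <= d -> In p (grid l e N) \/ p = l -> e / 6 <= rho test_point p.
Proof.
  intros hed hp.
  destruct (test_point_near hed) as (h1 & h2 & h3).
  pose proof grid_s_pos as hs.
  assert (hpl : Cmod (p - l) <= d / 2 * s).
  { destruct hp as [hp | ->]; [now apply grid_near |].
    replace (l - l)%C with (RtoC 0) by ring; rewrite Cmod_0; nra. }
  pose proof (near_bounds _ _ hpl) as hb.
  assert (hpd : disc p) by (unfold disc; nra).
  assert (hdist : s * e / 2 <= Cmod (test_point - p)).
  { destruct hp as [hp | ->]; [| lra].
    apply in_map_iff in hp; destruct hp as ([i j] & <- & _).
    eapply Rle_trans; [| apply re_le_Cmod].
    unfold Re, test_point, grid_point; simpl; fold s.
    replace (_ + _ + _) with (s * e * (/ 2 - (INR i - INR N))) by (unfold s; field).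
    rewrite Rabs_mult, (Rabs_pos_eq (s * e)) by nra.
    assert (/ 2 <= Rabs (/ 2 - (INR i - INR N))).
    { destruct (Nat.le_gt_cases i N) as [hi | hi].
      - apply le_INR in hi; rewrite Rabs_pos_eq; lra.
      - assert (h : (N + 1 <= i)%nat) by lia; apply le_INR in h; rewrite plus_INR in h; simpl in h.
        rewrite Rabs_left1; lra. }
    assert (0 < s * e) by nra. nra. }
  assert (hden : Cmod (1 - Cconj p * test_point) <= 3 * s).
  { replace (1 - Cconj p * test_point)%C with
      (RtoC (1 - Cmod p ^ 2) + Cconj p * (p - test_point))%C.
    2:{ rewrite RtoC_minus, RtoC_pow, <- RtoC_pow, Cmod2_conj; ring. }
    eapply Rle_trans; [apply Cmod_triangle |].
    destruct (disc_sqr p hpd) as [q1 q2].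
    rewrite Cmod_R, Rabs_pos_eq, Cmod_mult, Cmod_conj by lra.
    assert (ht : Cmod (p - test_point) <= d * s).
    { replace (p - test_point)%C with ((p - l) + - (test_point - l))%C by ring.
      eapply Rle_trans; [apply Cmod_triangle |]; rewrite Cmod_opp; lra. }
    unfold disc in hpd; pose proof (Cmod_ge_0 p); pose proof (Cmod_ge_0 (p - test_point)).
    nra. }
  rewrite rho_eq by easy.
  pose proof (den_pos test_point p h3 hpd).
  apply Rmult_le_reg_r with (Cmod (1 - Cconj p * test_point)); [easy |].
  unfold Rdiv at 2; rewrite Rmult_assoc, Rinv_l, Rmult_1_r by lra; nra.
Qed.

End Grid.

(** * Clusters of zeros *)

(** The second components in [cl k] serve as the constants [K i] of [blaschke_harmonic_majorant].
    Zeros and weights share one Cantor numbering, with [None] and weight 0 past the end of a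
    list. *)
Definition flatten_zeros (cl : nat -> list (C * R)) : nat -> option C :=
  cantor_flatten (fun k i => option_map fst (nth_error (cl k) i)).
Definition flatten_weights (cl : nat -> list (C * R)) : nat -> R :=
  cantor_flatten (fun k i => match nth_error (cl k) i with Some x => snd x | None => 0 end).

Section Flatten.

Variables (cl : nat -> list (C * R)) (S : nat -> R).
Hypothesis hcl : forall k x, In x (cl k) -> disc (fst x) /\ 1 <= snd x.
Hypothesis hsum : forall k, lsum (fun x => snd x * (1 - Cmod (fst x))) (cl k) <= S k.
Hypothesis hS : ex_series S.

Lemma flatten_weights_nonneg n : 0 <= flatten_weights cl n.
Proof.
  unfold flatten_weights, cantor_flatten.
  destruct (nth_error _ _) as [x |] eqn:e; [| lra].
  apply nth_error_In, hcl in e; lra.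
Qed.

Lemma flatten_zeros_inv n p : flatten_zeros cl n = Some p ->
  exists k, In (p, flatten_weights cl n) (cl k).
Proof.
  unfold flatten_zeros, flatten_weights, cantor_flatten.
  destruct (nth_error _ _) as [[p' w] |] eqn:e; [| easy].
  simpl; intros [= ->]; eexists; eapply nth_error_In; exact e.
Qed.

Lemma flatten_zeros_to_nat k i x : nth_error (cl k) i = Some x ->
  flatten_zeros cl (to_nat (k, i)) = Some (fst x).
Proof.
  intro e; unfold flatten_zeros, cantor_flatten; rewrite cancel_of_to; simpl; now rewrite e.
Qed.

Lemma flatten_summable :
  ex_series (fun n => flatten_weights cl n * zero_weight (flatten_zeros cl) n).
Proof.
  set (g := fun x : C * R => snd x * (1 - Cmod (fst x))).
  assert (hg : forall k x, In x (cl k) -> 0 <= g x).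
  { intros k x hx; destruct (hcl k x hx) as [h1 h2]; unfold disc in h1.
    apply Rmult_le_pos; lra. }
  apply ex_series_ext with
    (cantor_flatten (fun k i => match nth_error (cl k) i with Some x => g x | None => 0 end)).
  - intro n; unfold zero_weight, flatten_weights, flatten_zeros, cantor_flatten.
    destruct (nth_error _ _); simpl; [easy | ring].
  - apply ex_series_cantor with S; [| | easy].
    + intros k i; destruct (nth_error (cl k) i) eqn:e; [| lra].
      apply (hg k); eapply nth_error_In; exact e.
    + intros k m; eapply Rle_trans; [| apply hsum]; apply lsum_nth_error, hg.
Qed.

Lemma flatten_blaschke : blaschke_sequence (flatten_zeros cl).
Proof.
  split.
  - intros n p h; apply flatten_zeros_inv in h; destruct h as [k h]; now apply (hcl k _ h).
  - apply (@ex_series_le R_AbsRing R_CompleteNormedModule) with (2 := flatten_summable).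
    intro n; unfold norm; simpl; unfold abs; simpl.
    change (Rabs (zero_weight (flatten_zeros cl) n) <=
      flatten_weights cl n * zero_weight (flatten_zeros cl) n).
    unfold zero_weight; destruct (flatten_zeros cl n) as [p |] eqn:e;
      [| rewrite Rabs_R0, Rmult_0_r; lra].
    apply flatten_zeros_inv in e; destruct e as [k h].
    destruct (hcl k _ h) as [h1 h2]; unfold disc in h1; simpl in h1, h2.
    rewrite Rabs_pos_eq; nra.
Qed.

Lemma flatten_copies k l M : (forall i, (i < M)%nat -> exists w, nth_error (cl k) i = Some (l, w)) ->
  exists L, NoDup L /\ length L = M /\ forall n, In n L -> flatten_zeros cl n = Some l.
Proof.
  intro h; exists (map (fun i => to_nat (k, i)) (seq 0 M)); split; [| split].
  - apply FinFun.Injective_map_NoDup; [| apply seq_NoDup].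
    intros x y e; apply (f_equal of_nat) in e; rewrite !cancel_of_to in e; now injection e.
  - now rewrite length_map, length_seq.
  - intros n hn; apply in_map_iff in hn; destruct hn as (i & <- & hi); apply in_seq in hi.
    destruct (h i) as [w hw]; [lia |]; now apply (flatten_zeros_to_nat k i (l, w)).
Qed.

End Flatten.

Lemma rho_set_le_iff (x : R) z L :
  Rbar_le x (rho_set z L) <-> forall p, L p -> x <= rho z p.
Proof.
  unfold rho_set; set (E := fun r => exists l, L l /\ r = rho z l).
  destruct (Glb_Rbar_correct E) as [h1 h2]; split.
  - intros h p hp.
    apply (Rbar_le_trans x (Glb_Rbar E) (rho z p)); [easy |]; apply h1; now exists p.
  - intro h; apply h2; intros r (p & hp & ->); now apply h.
Qed.

(* A cluster consists of [M] copies of the center [l], which make the Blaschke product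
   small near [l], and of a grid of simple zeros so fine that no point near [l] is at
   distance [e^(-H)] from all of them.  The second components are the constants of the
   bounds [- ln rho <= K (1 - rho^2)] that hold off the [e^(-H)]-neighbourhoods. *)
Definition cluster (K T : R) (l : C) (e : R) (N M : nat) : list (C * R) :=
  repeat (l, K) M ++ map (fun p => (p, K * T)) (grid l e N).

Lemma in_cluster K T l e N M x : In x (cluster K T l e N M) ->
  x = (l, K) \/ exists p, In p (grid l e N) /\ x = (p, K * T).
Proof.
  intro h; apply in_app_iff in h; destruct h as [h | h].
  - left; now apply repeat_spec in h.
  - right; apply in_map_iff in h; destruct h as (p & <- & hp); now exists p.
Qed.

Section Cluster.

Variables (H : C -> R) (c T e : R) (l : C) (N M : nat).
Let d := c / 16.
(** The constant of [rho_sqr_ge] for k = 8 / d: off the disc of radius (d / 8) s about [l] one has s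
    <= (8 / d) |z - l|. *)
Let K := 1 + 4 * (8 / d) ^ 2 + 4 * (8 / d).
Hypotheses (hH : Har_pos H) (hc : 0 < c <= 1) (hl : disc l) (hT : H l = T) (hT1 : 1 <= T)
  (he : 4 * e = exp (- ((1 + c) * T))) (hN : d / 8 <= INR N * e <= d / 4).

Lemma cluster_K_ge : 3 <= K.
Proof.
  assert (0 < d <= / 16) by (unfold d; lra).
  assert (8 <= 8 / d).
  { apply Rmult_le_reg_r with d; [lra |]; unfold Rdiv; rewrite Rmult_assoc, Rinv_l; lra. }
  unfold K; nra.
Qed.

(** No admissible [z] is within (d / 8) s of [l]: there some grid point has rho < 4 e = e^(-(1+c)T)
    <= e^(-H z). Farther out, [K] serves for the center. For a grid zero it serves once |z - l| > d
    s; closer than that only -ln rho <= H z <= 2 T is available, together with rho <= 1 / 2, and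
    this costs the factor [T]. *)
Lemma cluster_estimate z :
  disc z -> (forall x, In x (cluster K T l e N M) -> exp (- H z) <= rho z (fst x)) ->
  forall x, In x (cluster K T l e N M) ->
  - ln (rho z (fst x)) <= snd x * (1 - rho z (fst x) ^ 2).
Proof.
  intros hz hE.
  assert (hd : 0 < d <= / 16) by (unfold d; lra).
  assert (he0 : 0 < e) by (pose proof (exp_pos (- ((1 + c) * T))); lra).
  pose proof (grid_s_pos l hl) as hs. set (s := 1 - Cmod l) in *.
  pose proof cluster_K_ge as hK.
  assert (hloc : Cmod (z - l) <= d * s -> H z <= (1 + c) * T).
  { intro h; rewrite <- hT; apply (Har_pos_local H z l c hH hl hc h). }
  assert (hfar : d / 8 * s < Cmod (z - l)).
  { apply Rnot_le_lt; intro hn.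
    destruct (grid_cover l e d N hl hd he0 hN z hz hn) as (p & hp & hr).
    assert (hin : In (p, K * T) (cluster K T l e N M)).
    { apply in_app_iff; right; apply (in_map (fun p => (p, K * T))); easy. }
    specialize (hE _ hin); simpl in hE.
    assert (exp (- ((1 + c) * T)) <= exp (- H z)); [| lra].
    assert (hz2 : H z <= (1 + c) * T) by (apply hloc; nra).
    destruct (Rle_lt_or_eq_dec _ _ hz2) as [h | ->]; [left; apply exp_increasing | right]; lra. }
  assert (hgen : forall p, disc p -> 0 < rho z p -> 1 - Cmod p <= 8 / d * Cmod (z - p) ->
    - ln (rho z p) <= K * (1 - rho z p ^ 2)).
  { intros p hp hr h; apply neg_ln_le_of_sqr_ge; [split; [easy | now apply rho_lt_1] |].
    apply rho_sqr_ge; try easy; apply Rdiv_lt_0_compat; lra. }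
  intros x hx.
  pose proof (exp_pos (- H z)) as hexp.
  assert (hpos := hE x hx).
  destruct (in_cluster _ _ _ _ _ _ _ hx) as [-> | (p & hp & ->)]; simpl fst in *; simpl snd in *.
  - apply hgen; [easy | lra |]; fold s.
    replace s with (8 / d * (d / 8 * s)) by (field; lra).
    apply Rmult_le_compat_l; [left; apply Rdiv_lt_0_compat |]; lra.
  - pose proof (grid_near l e d N hl he0 hN p hp) as hnear; fold s in hnear.
    pose proof (near_bounds l p _ hnear) as hb; fold s in hb.
    assert (hpd : disc p) by (now apply (grid_disc l e d N)).
    destruct (Rle_lt_dec (Cmod (z - l)) (d * s)) as [hzl | hzl].
    + assert (hr : rho z p <= / 2).
      { apply rho_le; [easy | easy |].
        replace (z - p)%C with ((z - l) + - (p - l))%C by ring.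
        eapply Rle_trans; [apply Cmod_triangle |]; rewrite Cmod_opp.
        assert (d * s <= / 16 * s) by (apply Rmult_le_compat_r; lra). nra. }
      pose proof (rho_nonneg z p).
      assert (hln : - ln (rho z p) <= H z).
      { apply ln_le in hpos; [rewrite ln_exp in hpos; lra | easy]. }
      specialize (hloc hzl).
      assert (- ln (rho z p) <= 2 * T) by nra.
      assert (3 / 4 <= 1 - rho z p ^ 2) by nra.
      assert (3 * T <= K * T) by (apply Rmult_le_compat_r; lra).
      assert (3 * T * (3 / 4) <= K * T * (1 - rho z p ^ 2)) by (apply Rmult_le_compat; lra).
      lra.
    + assert (hle : - ln (rho z p) <= K * (1 - rho z p ^ 2)).
      { apply hgen; [easy | lra |].
        assert (d / 2 * s <= Cmod (z - p)).
        { assert (Cmod (z - l) <= Cmod (z - p) + Cmod (p - l)); [| lra].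
          replace (z - l)%C with ((z - p) + (p - l))%C by ring; apply Cmod_triangle. }
        apply Rle_trans with (8 / d * (d / 2 * s)).
        - replace (8 / d * (d / 2 * s)) with (4 * s) by (field; lra); nra.
        - apply Rmult_le_compat_l; [left; apply Rdiv_lt_0_compat |]; lra. }
      eapply Rle_trans; [exact hle |].
      pose proof (rho_lt_1 z p hz hpd); pose proof (rho_nonneg z p).
      apply Rmult_le_compat_r; nra.
Qed.

(** The copies of the center take K q of the total and the grid 2 K q, as 1 - |p| <= 2 (1 - |l|) on
    it. *)
Lemma cluster_weight_sum q : INR M * (1 - Cmod l) <= q ->
  INR ((2 * N + 1) * (2 * N + 1)) * T * (1 - Cmod l) <= q ->
  lsum (fun x => snd x * (1 - Cmod (fst x))) (cluster K T l e N M) <= 3 * K * q.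
Proof.
  intros h1 h2.
  assert (hd : 0 < d <= / 16) by (unfold d; lra).
  assert (he0 : 0 < e) by (pose proof (exp_pos (- ((1 + c) * T))); lra).
  pose proof (grid_s_pos l hl) as hs. set (s := 1 - Cmod l) in *.
  pose proof cluster_K_ge as hK.
  unfold cluster; rewrite lsum_app, lsum_map.
  assert (q1 : lsum (fun x : C * R => snd x * (1 - Cmod (fst x))) (repeat (l, K) M) <= INR M * (K * s)).
  { rewrite <- (repeat_length (l, K) M) at 2; apply lsum_le_length.
    intros x hx; apply repeat_spec in hx; subst x; simpl; fold s; lra. }
  assert (q2 : lsum (fun p => K * T * (1 - Cmod p)) (grid l e N) <=
    INR ((2 * N + 1) * (2 * N + 1)) * (K * T * (2 * s))).
  { replace ((2 * N + 1) * (2 * N + 1))%nat with (length (grid l e N))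
      by (unfold grid; rewrite length_map, length_prod, length_seq; easy).
    apply lsum_le_length; intros p hp; apply Rmult_le_compat_l; [nra |].
    pose proof (near_bounds l p _ (grid_near l e d N hl he0 hN p hp)) as hb; fold s in hb; nra. }
  simpl in q2 |- *.
  assert (K * (INR M * s) <= K * q) by (apply Rmult_le_compat_l; lra).
  assert (K * (INR ((2 * N + 1) * (2 * N + 1)) * T * s) <= K * q) by (apply Rmult_le_compat_l; lra).
  simpl in H1; nra.
Qed.

End Cluster.

(** * Choice of the parameters *)

Lemma exp_5_ge : 24 <= exp 5.
Proof.
  assert (h1 : 2 < exp 1) by (pose proof (exp_ineq1 1); lra).
  replace 5 with (1 + (1 + (1 + (1 + 1)))) by ring; rewrite !exp_plus.
  set (x := exp 1) in *.
  assert (4 < x * x) by nra. assert (16 < (x * x) * (x * x)) by nra. nra.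
Qed.

Lemma INR_le_pow2 n : INR n <= 2 ^ n.
Proof.
  induction n; [simpl; lra |].
  rewrite S_INR; simpl; assert (1 <= 2 ^ n) by (apply pow_R1_Rle; lra); lra.
Qed.

(** [N] and the threshold are fixed before the scale [s], and every [s] below the threshold is
    allowed: this freedom is used to make the scales of successive clusters decrease fast. *)
Lemma cluster_parameters H T c q : Har_pos H -> unbounded_on_disc H -> H 0%C < T ->
  0 < c <= 1 -> 0 < q -> 2 / (c / 16) <= T ->
  exists Nb : nat * R,
    (c / 16) / 8 <= INR (fst Nb) * (exp (- ((1 + c) * T)) / 4) <= (c / 16) / 4 /\
    0 < snd Nb <= / 2 /\
    forall s, 0 < s <= snd Nb ->
      s <= q / 2 /\ INR ((2 * fst Nb + 1) * (2 * fst Nb + 1)) * T * s <= q /\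
      exists l, Cmod l = 1 - s /\ H l = T.
Proof.
  intros hH hunb hT hc hq hT2.
  set (d := c / 16) in *. assert (hd : 0 < d <= / 16) by (unfold d; lra).
  set (e := exp (- ((1 + c) * T)) / 4).
  assert (he : 0 < e) by (unfold e; pose proof (exp_pos (- ((1 + c) * T))); lra).
  assert (hT0 : 0 < T).
  { eapply Rlt_le_trans; [| exact hT2]; apply Rdiv_lt_0_compat; lra. }
  (* For the floor [N] of d / (4 e) one has N e > d / 4 - e, hence N e >= d / 8 by this bound, which
     comes from e^(-T) <= 1 / (1 + T) and 2 / d <= T. *)
  assert (hed : e <= d / 8).
  { assert (h1 : exp (- ((1 + c) * T)) <= exp (- T)).
    { left; apply exp_increasing; nra. }
    assert (h2 : exp (- T) <= / (1 + T)).
    { rewrite exp_Ropp; apply Rinv_le_contravar; [lra | apply exp_ineq1_le]. }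
    assert (h3 : / (1 + T) <= d / 2).
    { replace (d / 2) with (/ (2 / d)) by (field; lra).
      apply Rinv_le_contravar; [apply Rdiv_lt_0_compat |]; lra. }
    unfold e; lra. }
  destruct (nat_floor (d / (4 * e))) as [N [hN1 hN2]].
  { left; apply Rdiv_lt_0_compat; lra. }
  destruct (Har_pos_level H T hH hunb hT) as (r0 & hr0 & hlev).
  set (X := INR ((2 * N + 1) * (2 * N + 1)) * T).
  assert (hX : 0 <= X) by (apply Rmult_le_pos; [apply pos_INR | lra]).
  set (b := Rmin (Rmin (/ 2) ((1 - r0) / 2)) (Rmin (q / 2) (q / (X + 1)))).
  assert (hb : 0 < b /\ b <= / 2 /\ b <= (1 - r0) / 2 /\ b <= q / 2 /\ b <= q / (X + 1)).
  { unfold b; split.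
    - repeat apply Rmin_pos; try lra; apply Rdiv_lt_0_compat; lra.
    - pose proof (Rmin_l (Rmin (/ 2) ((1 - r0) / 2)) (Rmin (q / 2) (q / (X + 1)))).
      pose proof (Rmin_r (Rmin (/ 2) ((1 - r0) / 2)) (Rmin (q / 2) (q / (X + 1)))).
      pose proof (Rmin_l (/ 2) ((1 - r0) / 2)). pose proof (Rmin_r (/ 2) ((1 - r0) / 2)).
      pose proof (Rmin_l (q / 2) (q / (X + 1))). pose proof (Rmin_r (q / 2) (q / (X + 1))). lra. }
  destruct hb as (b0 & b1 & b2 & b3 & b4).
  exists (N, b); simpl fst; simpl snd; split; [| split; [lra |]].
  - apply (Rmult_le_compat_r (4 * e)) in hN1; [| lra].
    apply (Rmult_lt_compat_r (4 * e)) in hN2; [| lra].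
    replace (d / (4 * e) * (4 * e)) with d in hN1, hN2 by (field; lra). lra.
  - intros s hs; split; [lra |]; split.
    + fold X; apply Rle_trans with ((X + 1) * (q / (X + 1))).
      * apply Rmult_le_compat; lra.
      * right; field; lra.
    + destruct (hlev (1 - s)) as (l & h1 & h2); [lra | lra |]; now exists l.
Qed.

(** The ratio 10, against the 8 of [rho_ge_half], leaves room for the points of a cluster, whose
    distances to the circle differ from the scale by a factor between 1 - d / 2 and 1 + d / 2. *)
Lemma decreasing_scales (b : nat -> R) : (forall k, 0 < b k) ->
  exists s : nat -> R, (forall k, 0 < s k <= b k) /\
    forall j k, (j < k)%nat -> s k <= s j / 10.
Proof.
  intro hb.
  set (s := fix s k := match k with O => b O | S k => Rmin (s k / 10) (b (S k)) end).
  assert (h : forall k, 0 < s k <= b k).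
  { induction k; simpl; [specialize (hb 0%nat); lra |].
    split; [apply Rmin_pos; [lra | apply hb] | apply Rmin_r]. }
  exists s; split; [easy |].
  intros j k hjk; induction hjk as [| k hjk IH]; simpl; [apply Rmin_l |].
  eapply Rle_trans; [apply Rmin_l |]; specialize (h k); lra.
Qed.

(** * The product over all clusters and its majorants *)

Theorem theorem3 (eta0 : R) (heta0 : 0 < eta0) (H : C -> R)
  (hH : Har_pos H) (hunb : unbounded_on_disc H) :
  exists B : C -> C,
    is_blaschke_product B /\ calH B H /\
    ~ calH B (fun z : C => (1 + eta0) * H z).
Proof.
  (* [(1 + eta0) (1 - c) > 1 + c], so that the scale [e^(-(1+c)T)] of the grid is still
     larger than [e^(-(1+eta0)H)] wherever [H >= (1 - c) T]. *)
  set (c := eta0 / (2 * (2 + eta0))).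
  assert (hc : 0 < c <= 1).
  { split; [apply Rdiv_lt_0_compat; lra |].
    apply Rmult_le_reg_r with (2 * (2 + eta0)); [lra |].
    unfold c; replace (eta0 / (2 * (2 + eta0)) * (2 * (2 + eta0))) with eta0 by (field; lra); lra. }
  assert (hceta : (1 + eta0) * (1 - c) = 1 + c + eta0 / 2) by (unfold c; field; lra).
  set (d := c / 16). assert (hd : 0 < d <= / 16) by (unfold d; lra).
  set (K := 1 + 4 * (8 / d) ^ 2 + 4 * (8 / d)).
  assert (hK : 3 <= K) by now apply cluster_K_ge.
  assert (hH0 : 0 < H 0%C) by (apply hH, disc_0).
  (* The summand 1 gives [T k >= 1], [H 0] gives points on the level [T k], 10 / eta0 the margin in
     [hexp], and 2 / d a grid step small compared with [d]. *)
  set (T0 := 1 + H 0%C + 10 / eta0 + 2 / d).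
  assert (p1 : 0 < 10 / eta0) by (apply Rdiv_lt_0_compat; lra).
  assert (p2 : 0 < 2 / d) by (apply Rdiv_lt_0_compat; lra).
  (* Up to a constant, [q k] bounds the weighted Blaschke sum of the k-th cluster: it is summable,
     while [q k * T k] is T0 2^k. *)
  set (T := fun k : nat => T0 * 4 ^ k). set (q := fun k : nat => (/ 2) ^ k).
  assert (hTT0 : forall k, T0 <= T k).
  { intro k; unfold T; assert (1 <= 4 ^ k) by (apply pow_R1_Rle; lra); unfold T0 in *; nra. }
  assert (hq : forall k, 0 < q k) by (intro; apply pow_lt; lra).
  set (e := fun k => exp (- ((1 + c) * T k)) / 4).
  assert (he0 : forall k, 0 < e k) by (intro k; pose proof (exp_pos (- ((1 + c) * T k))); unfold e; lra).
  destruct (functional_choice _ (fun k => cluster_parameters H (T k) c (q k) hH hunb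
    ltac:(specialize (hTT0 k); unfold T0 in hTT0; lra) hc (hq k)
    ltac:(specialize (hTT0 k); unfold T0 in hTT0; fold d; lra))) as [Nb hNb].
  set (N := fun k => fst (Nb k)).
  destruct (decreasing_scales (fun k => snd (Nb k))) as (s & hs & hss).
  { intro k; apply (hNb k). }
  assert (hlM : forall k, exists lM : C * nat, Cmod (fst lM) = 1 - s k /\ H (fst lM) = T k /\
    INR (snd lM) * s k <= q k /\ q k / 2 <= INR (snd lM) * s k).
  { intro k; destruct (hNb k) as (_ & _ & h); specialize (hs k).
    destruct (h (s k) hs) as (h1 & _ & l & h2 & h3).
    (* Rounding down loses less than one copy, of weight s k <= q k / 2, so that M s k remains at
       least q k / 2. *)
    destruct (nat_floor (q k / s k)) as [M [m1 m2]].
    { left; apply Rdiv_lt_0_compat; [apply hq | lra]. }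
    exists (l, M); simpl; repeat split; try easy.
    - apply (Rmult_le_compat_r (s k)) in m1; [| lra].
      replace (q k / s k * s k) with (q k) in m1 by (field; lra); easy.
    - apply (Rmult_lt_compat_r (s k)) in m2; [| lra].
      replace (q k / s k * s k) with (q k) in m2 by (field; lra); lra. }
  destruct (functional_choice _ hlM) as [lM hlM'].
  set (l := fun k => fst (lM k)). set (M := fun k => snd (lM k)).
  assert (hl : forall k, disc (l k)).
  { intro k; destruct (hlM' k) as (h & _); unfold disc, l; rewrite h; specialize (hs k); lra. }
  assert (hsl : forall k, 1 - Cmod (l k) = s k).
  { intro k; destruct (hlM' k) as (h & _); unfold l; rewrite h; lra. }
  assert (hHl : forall k, H (l k) = T k) by (intro k; apply hlM').
  assert (hT1 : forall k, 1 <= T k) by (intro k; specialize (hTT0 k); unfold T0 in hTT0; lra).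
  assert (he : forall k, 4 * e k = exp (- ((1 + c) * T k))) by (intro k; unfold e; field).
  assert (hN : forall k, d / 8 <= INR (N k) * e k <= d / 4) by (intro k; apply (hNb k)).
  assert (hed : forall k, e k <= d).
  { intro k; specialize (hN k); specialize (he0 k).
    destruct (Nat.eq_dec (N k) 0) as [h0 | h0]; [rewrite h0 in hN; simpl in hN; lra |].
    assert (h1 : (1 <= N k)%nat) by lia; apply le_INR in h1; simpl in h1; nra. }
  set (cl := fun k => cluster K (T k) (l k) (e k) (N k) (M k)).
  assert (hclm : forall k x, In x (cl k) -> Cmod (fst x - l k) <= d / 2 * s k /\ 1 <= snd x /\
    (In (fst x) (grid (l k) (e k) (N k)) \/ fst x = l k)).
  { intros k x hx; specialize (hs k); destruct (in_cluster _ _ _ _ _ _ _ hx) as [-> | (p & hp & ->)]; simpl.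
    - replace (l k - l k)%C with (RtoC 0) by ring; rewrite Cmod_0.
      split; [nra | split; [lra | now right]].
    - split; [| split; [specialize (hT1 k); nra | now left]].
      rewrite <- (hsl k); now apply (grid_near (l k) (e k) d (N k)). }
  assert (hclb : forall k x, In x (cl k) -> s k * (1 - d / 2) <= 1 - Cmod (fst x) <= s k * (1 + d / 2)).
  { intros k x hx; rewrite <- (hsl k); apply near_bounds; rewrite hsl; now apply hclm. }
  assert (hcl : forall k x, In x (cl k) -> disc (fst x) /\ 1 <= snd x).
  { intros k x hx; split; [| now apply (hclm k)].
    specialize (hclb k x hx); specialize (hs k); unfold disc; nra. }
  assert (hsum : forall k, lsum (fun x => snd x * (1 - Cmod (fst x))) (cl k) <= 3 * K * q k).
  { intro k; destruct (hNb k) as (_ & _ & h); destruct (h (s k) (hs k)) as (_ & h1 & _).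
    apply (cluster_weight_sum c (T k) (e k) (l k) (N k) (M k)); try easy; rewrite hsl; [apply hlM' | exact h1]. }
  assert (hqs : ex_series (fun k => 3 * K * q k)).
  { apply (ex_series_scal_l (3 * K) q), ex_series_geom; rewrite Rabs_pos_eq; lra. }
  set (a := flatten_zeros cl). set (w := flatten_weights cl).
  assert (ha : blaschke_sequence a) by exact (flatten_blaschke cl _ hcl hsum hqs).
  assert (hzero : forall k x, In x (cl k) -> zero_set (blaschke_product a) (fst x)).
  { intros k x hx; apply In_nth_error in hx; destruct hx as [i hi].
    apply (blaschke_product_zero a ha (to_nat (k, i))); now apply flatten_zeros_to_nat. }
  exists (blaschke_product a); split; [now apply is_blaschke_product_intro | split].
  - split; [easy |].
    destruct (blaschke_harmonic_majorant a ha w (flatten_weights_nonneg cl hcl)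
      (flatten_summable cl _ hcl hsum hqs)) as (H1 & hH1 & hmaj).
    exists H1; split; [easy |]; intros z [hz hE]; apply hmaj; [easy |].
    rewrite rho_set_le_iff in hE.
    intro i; unfold rho_at; destruct (a i) as [p |] eqn:ei; [| rewrite ln_1; lra].
    destruct (flatten_zeros_inv cl i p ei) as [k hk].
    split.
    + pose proof (exp_pos (- H z)); specialize (hE p (hzero k _ hk)); lra.
    + apply (cluster_estimate H c (T k) (e k) (l k) (N k) (M k) hH hc (hl k) (hHl k) (hT1 k)
        (he k) (hN k) z hz) with (x := (p, w i)); [| exact hk].
      intros x hx; apply hE, (hzero k x hx).
  - intros [_ (h & hh & hmaj)].
    assert (hh0 : 0 < h 0%C) by (apply hh, disc_0).
    (* At the test point [z] of the k-th cluster, M T <= -ln |B z| <= h z <= 4 h(0) / (1 - |z|) with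
       1 - |z| >= s / 2. Together with M s >= q / 2 this gives q T <= 16 h(0). *)
    assert (key : forall k, T0 * 2 ^ k <= 16 * h 0%C).
    { intro k.
      set (z := test_point (l k) (e k)).
      destruct (test_point_near (l k) (e k) d (hl k) hd (he0 k) (hed k)) as (z1 & z2 & hz).
      fold z in z1, z2, hz.
      pose proof (near_bounds (l k) z _ z2) as hzb; rewrite (hsl k) in z1, z2, hzb.
      assert (hsk := hs k).
      assert (hHz : (1 - c) * T k <= H z).
      { rewrite <- (hHl k); apply (Har_pos_local H z (l k) c hH (hl k) hc).
        rewrite hsl; fold d; nra. }
      (* (1 + eta0) (1 - c) T exceeds (1 + c) T by eta0 T / 2 >= 5, and e^5 >= 24 turns the scale 4
         e into e / 6, the separation of [z] from the grid. *)
      assert (hexp : exp (- ((1 + eta0) * H z)) <= e k / 6).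
      { apply Rle_trans with (exp (- ((1 + c) * T k) - 5)).
        - assert (hle : - ((1 + eta0) * H z) <= - ((1 + c) * T k) - 5).
          { assert (10 <= eta0 * T k).
            { replace 10 with (eta0 * (10 / eta0)) by (field; lra).
              apply Rmult_le_compat_l; [lra |]; specialize (hTT0 k); unfold T0 in hTT0; lra. }
            assert ((1 + eta0) * ((1 - c) * T k) <= (1 + eta0) * H z) by (apply Rmult_le_compat_l; lra).
            rewrite <- Rmult_assoc, hceta in H1; lra. }
          destruct (Rle_lt_or_eq_dec _ _ hle) as [hlt | ->]; [left; now apply exp_increasing | lra].
        - unfold Rminus; rewrite exp_plus, (exp_Ropp 5), <- he; specialize (he0 k).
          replace (e k / 6) with (4 * e k * / 24) by field.
          apply Rmult_le_compat_l; [lra |]; apply Rinv_le_contravar; [lra | apply exp_5_ge]. }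
      assert (hsep : forall p, zero_set (blaschke_product a) p -> e k / 6 <= rho z p).
      { intros p hp; apply (zero_set_blaschke_product a ha) in hp; destruct hp as [n hn].
        destruct (flatten_zeros_inv cl n p hn) as [j hj].
        destruct (Nat.eq_dec j k) as [-> | hjk].
        - apply (test_point_rho_grid (l k) (e k) d (N k)); try easy.
          now destruct (hclm k _ hj) as (_ & _ & hg).
        - apply Rle_trans with (/ 2); [specialize (hed k); lra |].
          apply rho_ge_half; [easy | now apply (hcl j _ hj) |].
          pose proof (hclb j _ hj) as hpb; simpl fst in hpb; assert (hsj := hs j).
          destruct (Nat.lt_gt_cases j k) as [hcase _]; destruct (hcase hjk) as [hlt | hlt];
            apply hss in hlt; [left | right]; nra. }
      assert (hB : blaschke_product a z <> 0).
      { intro h0; specialize (hsep z (conj hz h0)); rewrite rho_diag in hsep.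
        specialize (he0 k); lra. }
      assert (hE : - ln (Cmod (blaschke_product a z)) <= h z).
      { apply hmaj; split; [easy |]; apply rho_set_le_iff; intros p hp.
        specialize (hsep p hp); lra. }
      destruct (flatten_copies cl k (l k) (M k)) as (L & hL1 & hL2 & hL3).
      { intros i hi; exists K; unfold cl, cluster.
        rewrite nth_error_app1 by (rewrite repeat_length; easy).
        now apply nth_error_repeat. }
      pose proof (neg_ln_blaschke_product_ge a ha z (l k) L hz hB hL1 hL3) as hlow.
      rewrite hL2 in hlow.
      assert (hln : T k <= - ln (rho z (l k))).
      { assert (hr : rho z (l k) <= exp (- T k)).
        { apply Rle_trans with (e k / 2).
          - exact (test_point_rho_center (l k) (e k) d (hl k) hd (he0 k) (hed k)).
          - specialize (he k); pose proof (exp_pos (- T k)).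
            assert (exp (- ((1 + c) * T k)) <= exp (- T k)); [| lra].
            left; apply exp_increasing; specialize (hT1 k); nra. }
        apply ln_le in hr; [rewrite ln_exp in hr; lra |].
        apply Rlt_le_trans with (e k / 6); [specialize (he0 k); lra |].
        apply (test_point_rho_grid (l k) (e k) d (N k)); try easy; now right. }
      pose proof (Har_pos_growth h z hh hz) as hgrow.
      assert (hMT : INR (M k) * T k <= 4 * h 0%C / (1 - Cmod z)).
      { assert (INR (M k) * T k <= INR (M k) * - ln (rho z (l k)))
          by (apply Rmult_le_compat_l; [apply pos_INR | easy]).
        lra. }
      assert (hz2 : s k / 2 <= 1 - Cmod z) by nra.
      assert (hMT2 : INR (M k) * T k * s k <= 8 * h 0%C).
      { apply (Rmult_le_compat_r (1 - Cmod z)) in hMT; [| lra].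
        replace (4 * h 0%C / (1 - Cmod z) * (1 - Cmod z)) with (4 * h 0%C) in hMT by (field; lra).
        assert (0 <= INR (M k) * T k) by (apply Rmult_le_pos; [apply pos_INR | specialize (hT1 k); lra]).
        nra. }
      destruct (hlM' k) as (_ & _ & _ & hqM); fold (M k) in hqM.
      assert (q k / 2 * T k <= INR (M k) * s k * T k).
      { apply Rmult_le_compat_r; [specialize (hT1 k); lra | easy]. }
      assert (q k * T k = T0 * 2 ^ k); [| lra].
      unfold q, T; replace 4 with (2 * 2) by ring.
      rewrite Rpow_mult_distr, pow_inv; field; apply pow_nonzero; lra. }
    destruct (nat_floor (16 * h 0%C)) as [n [_ hn]]; [lra |].
    specialize (key (S n)); pose proof (INR_le_pow2 (S n)) as hp; rewrite S_INR in hp.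
    assert (1 <= T0) by (unfold T0; lra).
    assert (1 * 2 ^ S n <= T0 * 2 ^ S n) by (apply Rmult_le_compat_r; [apply pow_le |]; lra).
    lra.
Qed.
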